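(* Let $(X,g)$ be a Riemannian manifold (not necessarily complete), let $\mu,w$ be smooth strictly positive functions on $X$ with $w$ bounded, and let $X=U\cup V$ with $U,V\subset X$ open. Suppose that the image of $d$ is almost closed in degree $k$ with respect to $w$ on each of $X,U,V$ and $U\cap V$, and that the sequence $$\{0\}\to\mathcal C^{k-1}_{w,\mu}(X)\xrightarrow{r^*}\mathcal C^{k-1}_{w,\mu}(U)\oplus\mathcal C^{k-1}_{w,\mu}(V)\xrightarrow{\delta}\mathcal C^{k-1}_{w,\mu}(U\cap V)\to\{0\}$$ is exact. Then the following sequence is exact: $$\mathbb H^{k-1}_{w\mu}(U)\oplus\mathbb H^{k-1}_{w\mu}(V)\xrightarrow{\delta}\mathbb H^{k-1}_{w\mu}(U\cap V)\xrightarrow{b}\mathbb H^k_\mu(X)\xrightarrow{r^*}\mathbb H^k_\mu(U)\oplus\mathbb H^k_\mu(V)\xrightarrow{\delta}\mathbb H^k_\mu(U\cap V).$$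
   Context: For a weight $\mu>0$ on a Riemannian manifold $M$, $L^2_\mu(\Lambda^kT^*M)$ is the space of $k$-forms square integrable for the measure $\mu\, d\mathrm{vol}_g$, and $d$ is taken in the distributional sense. Put $Z^k_\mu(M)=\{\alpha\in L^2_\mu(\Lambda^kT^*M):d\alpha=0\}$, let $B^k_\mu(M)$ be the $L^2_\mu$-closure of $\{d\alpha:\alpha\in L^2_\mu(\Lambda^{k-1}T^*M),\ d\alpha\in L^2_\mu\}$, and $\mathbb H^k_\mu(M)=Z^k_\mu(M)/B^k_\mu(M)$ (reduced weighted $L^2$ cohomology). Put $$\mathcal C^{k-1}_{w,\mu}(M)=\{\alpha\in L^2_{w\mu}(\Lambda^{k-1}T^*M):d\alpha\in L^2_\mu(\Lambda^kT^*M)\}.$$ The image of $d$ is *almost closed* on $M$ in degree $k$ with respect to $w$ if $d\,\mathcal C^{k-1}_{w,\mu}(M)$ is closed in $L^2_\mu$ and equals $B^k_\mu(M)$. Maps: $r^*$ is restriction to $U$ and to $V$; $\delta(\alpha,\beta)=\alpha|_{U\cap V}-\beta|_{U\cap V}$. The map $b$: for $\eta\in Z^{k-1}_{w\mu}(U\cap V)$ choose $(\psi_U,\psi_V)\in\mathcal C^{k-1}_{w,\mu}(U)\oplus\mathcal C^{k-1}_{w,\mu}(V)$ with $\eta=\psi_U|_{U\cap V}-\psi_V|_{U\cap V}$; then $b[\eta]=[\varphi]$ where $\varphi\in Z^k_\mu(X)$ is the form with $\varphi|_U=d\psi_U$ and $\varphi|_V=d\psi_V$.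
   Formalization: The map b is read as a linear relation on classes: [φ] is shown to exist and be unique for each closed form η, but cohomologous η may give different [φ], since the hypotheses do not make b well defined on classes; exactness is stated for this relation. *)

(* Defs.v *)
From mathcomp Require Import all_boot all_order all_algebra.
From mathcomp Require Import all_classical all_reals all_analysis.

Set Implicit Arguments.
Unset Strict Implicit.
Unset Printing Implicit Defensive.

Import Order.TTheory GRing.Theory Num.Theory.
Import numFieldNormedType.Exports.

Local Open Scope classical_set_scope.
Local Open Scope ring_scope.

Definition borel (M : ptopologicalType) := g_sigma_algebraType (@open M).

Section euclidean.
Variables (R : realType) (n : nat).
Implicit Types (O : set 'rV[R]_n) (f : 'rV[R]_n -> R).

Definition partial (j : 'I_n) f : 'rV[R]_n -> R :=
  fun x => 'D_(delta_mx ord0 j) f x.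

(* C^oo on an open set O: all iterated partial derivatives exist and are
   differentiable (hence continuous) at the points of O. *)
Definition smooth_on O f :=
  forall (s : seq 'I_n) x, O x -> differentiable (foldr partial f s) x.

(* f is in C^oo_c(O), extended by 0. *)
Definition test_function O f :=
  smooth_on setT f /\
  exists K, [/\ compact K, K `<=` O & forall x, ~ K x -> f x = 0].

Definition box (a b : 'rV[R]_n) : set 'rV[R]_n :=
  [set x | forall j, a ord0 j <= x ord0 j <= b ord0 j].

Definition box_volume (a b : 'rV[R]_n) : R :=
  \prod_j Num.max 0 (b ord0 j - a ord0 j).

(* Lebesgue (outer) measure of R^n: infimum over countable covers by boxes,
   indexed by a set D of naturals so that finite covers are allowed. *)
Definition lebesgue_Rn (A : set 'rV[R]_n) : \bar R :=
  ereal_inf [set l | exists (D : set nat) (a b : nat -> 'rV[R]_n),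
    A `<=` \bigcup_(i in D) box (a i) (b i) /\
    l = (\esum_(i in D) (box_volume (a i) (b i))%:E)%E].

(* Alternating k-linear forms on R^n; the k arguments are the rows of a
   matrix. *)
Definition alternating k (f : 'M[R]_(k, n) -> R) :=
  (forall (A B C : 'M[R]_(k, n)) i b c,
     row i A = b *: row i B + c *: row i C ->
     row' i B = row' i A -> row' i C = row' i A -> f A = b * f B + c * f C) /\
  (forall (A : 'M[R]_(k, n)) i j, i != j -> row i A = row j A -> f A = 0).

(* The family of standard basis vectors (e_(s 0), ..., e_(s (k-1))). *)
Definition frame k (s : {ffun 'I_k -> 'I_n}) : 'M[R]_(k, n) :=
  \matrix_(a, b) (b == s a)%:R.

(* Squared norm on alternating k-forms induced by the Gram matrix g:
   |f|^2 = 1/k! sum_(s,t) g^{s_1 t_1} ... g^{s_k t_k} f_s f_t. *)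
Definition form_normsq k (g : 'M[R]_n) (f : 'M[R]_(k, n) -> R) : R :=
  (k`!%:R)^-1 * \sum_(s : {ffun 'I_k -> 'I_n}) \sum_(t : {ffun 'I_k -> 'I_n})
    (\prod_a invmx g (s a) (t a)) * f (frame s) * f (frame t).

End euclidean.

Record chart (R : realType) (n : nat) (M : ptopologicalType) := Chart {
  chart_dom : set M;
  chart_map :> M -> 'rV[R]_n;
  chart_inv : 'rV[R]_n -> M }.

Definition chart_image R n M (c : chart R n M) (U : set M) : set 'rV[R]_n :=
  c @` (U `&` chart_dom c).

Record smoothManifold (R : realType) := SmoothManifold {
  carrier :> ptopologicalType;
  dim : nat;
  atlas : set (chart R dim carrier);
  chart_at : carrier -> chart R dim carrier;
  manifold_hausdorff : hausdorff_space carrier;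
  manifold_second_countable : @second_countable carrier;
  chart_at_atlas : forall p, atlas (chart_at p);
  chart_at_dom : forall p, chart_dom (chart_at p) p;
  chart_homeo : forall c, atlas c ->
    [/\ open (chart_dom c), open (chart_image c setT),
        forall p, chart_dom c p -> chart_inv c (c p) = p,
        {in chart_dom c, continuous c} &
        {in chart_image c setT, continuous (chart_inv c)}];
  chart_transition : forall c c' (i : 'I_dim), atlas c -> atlas c' ->
    smooth_on (chart_image c (chart_dom c'))
              (fun x => c' (chart_inv c x) ord0 i) }.

Section tensors.
Variables (R : realType) (M : smoothManifold R).
Local Notation n := (dim M).
Implicit Types (c : chart R n M) (U : set M).

Definition smooth_fun (f : M -> R) :=
  forall c, atlas c -> smooth_on (chart_image c setT) (f \o chart_inv c).

(* The tangent space at p is identified with R^n through the preferred chart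
   chart_at p.  A tangent vector with coordinates v (a row) in the chart c has
   coordinates v *m change_of_chart c p in the chart chart_at p. *)
Definition change_of_chart c (p : M) : 'M[R]_n :=
  jacobian (chart_at p \o chart_inv c) (c p).

(* Differential k-forms (no regularity): at p, a function of k tangent vectors
   at p.  Alternation is part of L2 below.  A form "on U" is such a function
   whose values outside U are irrelevant, so that restriction to a smaller
   open set does not change the underlying function. *)
Definition form k := M -> 'M[R]_(k, n) -> R.

Definition form_in c k (a : form k) (p : M) (v : 'M[R]_(k, n)) : R :=
  a p (v *m change_of_chart c p).

Definition metric_in c (g : M -> 'M[R]_n) (p : M) : 'M[R]_n :=
  change_of_chart c p *m g p *m (change_of_chart c p)^T.

End tensors.

Record riemannianManifold (R : realType) := RiemannianManifold {
  smooth_manifold :> smoothManifold R;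
  (* Gram matrix of the metric at p, in the chart chart_at p *)
  metric : smooth_manifold -> 'M[R]_(dim smooth_manifold);
  metric_sym : forall p, (metric p)^T = metric p;
  metric_pos : forall p (v : 'rV[R]_(dim smooth_manifold)), v != 0 ->
    0 < (v *m metric p *m v^T) ord0 ord0;
  metric_smooth : forall c i j, atlas c ->
    smooth_on (chart_image c setT)
              (fun x => metric_in c metric (chart_inv c x) i j);
  (* The Riemannian measure, the unique Borel measure which is
     sqrt (det g) dx in every chart; equivalently, 1 / sqrt (det g) times it is
     the Lebesgue measure dx of the chart. *)
  vol : {measure set (borel smooth_manifold) -> \bar R};
  volE : forall c (A : set (borel smooth_manifold)), atlas c -> measurable A ->
    A `<=` chart_dom c ->
    (\int[vol]_(p in A) ((Num.sqrt (\det (metric_in c metric p)))^-1)%:E)%E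
    = lebesgue_Rn (c @` A) }.

Section weighted_cohomology.
Variables (R : realType) (X : riemannianManifold R).
Local Notation n := (dim X).
Implicit Types (U : set X) (nu mu w : X -> R) (c : chart R n X).

Definition measurable_form U k (a : form X k) :=
  forall c (s : {ffun 'I_k -> 'I_n}), atlas c ->
    measurable_fun (U `&` chart_dom c : set (borel X))
      (fun p : borel X => form_in c a p (frame R s)).

Definition L2_normsq nu U k (a : form X k) : \bar R :=
  (\int[@vol R X]_(p in U) (nu p * form_normsq (metric p) (a p))%:E)%E.

Definition L2 nu U k : set (form X k) :=
  [set a | [/\ forall p, U p -> alternating (a p), measurable_form U a
             & (L2_normsq nu U a < +oo)%E]].

Definition L2_closure nu U k (S : set (form X k)) : set (form X k) :=
  [set a | L2 nu U a /\ forall e : R, 0 < e ->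
     exists2 b, S b & (L2_normsq nu U (a - b)%R < e%:E)%E].

Definition ae_zero U k : set (form X k) :=
  [set a | {ae @vol R X, forall p, U p -> a p = 0}].

Definition locally_integrable_form U k (a : form X k) :=
  forall c (s : {ffun 'I_k -> 'I_n}) (K : set X), atlas c -> compact K ->
    K `<=` U `&` chart_dom c ->
    (@vol R X).-integrable (K : set (borel X))
      (fun p => (form_in c a p (frame R s))%:E).

(* Integral over A of h dx, dx being the Lebesgue measure of the chart c. *)
Definition chart_integral c (A : set X) (h : X -> R) : R :=
  \int[@vol R X]_(p in A)
    (h p / Num.sqrt (\det (metric_in c (@metric R X) p))).

(* b = d a on U in the distributional sense: in every chart,
   b_s = sum_i (-1)^i d_(s i) a_(s minus s i) as distributions, i.e. after
   moving the derivatives on the test function f. *)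
Definition weak_d U k (a : form X k) (b : form X k.+1) :=
  [/\ locally_integrable_form U a, locally_integrable_form U b &
   forall c (f : 'rV[R]_n -> R) (s : {ffun 'I_k.+1 -> 'I_n}), atlas c ->
     test_function (chart_image c U) f ->
     chart_integral c (U `&` chart_dom c)
       (fun p => form_in c b p (frame R s) * f (c p))
     = - \sum_(i < k.+1) (-1) ^+ i *
         chart_integral c (U `&` chart_dom c)
           (fun p => form_in c a p (row' i (frame R s)) *
                     partial (s i) f (c p))].

Definition closed_forms nu U k : set (form X k) :=
  [set a | L2 nu U a /\ weak_d U a 0].

Definition C_forms w mu U k : set (form X k) :=
  [set a | L2 (fun p => w p * mu p) U a /\
           exists2 b : form X k.+1, weak_d U a b & L2 mu U b].

Definition d_C_forms w mu U k : set (form X k.+1) :=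
  [set b | L2 mu U b /\ exists2 a : form X k, C_forms w mu U a & weak_d U a b].

(* There are no forms of degree -1. *)
Definition exact_forms nu U k : set (form X k) :=
  match k with
  | 0 => [set 0]
  | k'.+1 => [set b | L2 nu U b /\
                      exists2 a : form X k', L2 nu U a & weak_d U a b]
  end.

Definition B_forms nu U k : set (form X k) :=
  L2_closure nu U (@exact_forms nu U k).

(* The image of d is almost closed on U in degree k.+1. *)
Definition almost_closed w mu U k :=
  L2_closure mu U (@d_C_forms w mu U k) `<=` @d_C_forms w mu U k /\
  @d_C_forms w mu U k = @B_forms mu U k.+1.

(* A quotient num / den of spaces of forms; its elements are the cosets. *)
Record quotient k := Quotient { num : set (form X k); den : set (form X k) }.

Definition coset k (Q : quotient k) (a : form X k) : set (form X k) :=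
  [set b | num Q b /\ den Q (b - a)].

(* C^k_{w,mu}(U): elements of L^2 are forms up to a.e. equality. *)
Definition C_space w mu U k := Quotient (@C_forms w mu U k) (@ae_zero U k).

(* Reduced weighted L^2 cohomology H^k_nu(U). *)
Definition H_space nu U k :=
  Quotient (@closed_forms nu U k) (@B_forms nu U k).

(* Maps between quotients are given by their graphs. *)

Definition restriction k (QX QU QV : quotient k)
    (x : set (form X k)) (y : set (form X k) * set (form X k)) :=
  exists2 a, num QX a & x = coset QX a /\ y = (coset QU a, coset QV a).

Definition difference k (QU QV QW : quotient k)
    (x : set (form X k) * set (form X k)) (y : set (form X k)) :=
  exists a b, [/\ num QU a, num QV b,
                  x = (coset QU a, coset QV b) & y = coset QW (a - b)].

Definition from_zero k (Q : quotient k) (_ : unit) (y : set (form X k)) :=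
  y = coset Q 0.

Definition to_zero k (Q : quotient k) (x : set (form X k)) (_ : unit) :=
  exists2 a, num Q a & x = coset Q a.

Definition exact_at (A B C : Type) (f : A -> B -> Prop) (g : B -> C -> Prop)
    (zero : C) :=
  forall y, (exists x, f x y) <-> g y zero.

(* For a closed form eta on U `&` V: y is the class of a form phi on X obtained
   by writing eta = psiU - psiV and gluing d psiU and d psiV. *)
Definition connecting_form w mu U V k (eta : form X k)
    (y : set (form X k.+1)) :=
  exists psiU psiV phi,
    [/\ C_forms w mu U psiU /\ C_forms w mu V psiV,
        @ae_zero (U `&` V) k (eta - (psiU - psiV)),
        closed_forms mu setT phi,
        weak_d U psiU phi /\ weak_d V psiV phi
      & y = coset (H_space mu setT k.+1) phi].

(* The graph of the connecting map b : the set of pairs ([eta], [phi]).  For a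
   given eta the class [phi] does not depend on the choices of psiU and psiV,
   but two cohomologous eta need not give the same class, because nothing is
   assumed about forms of degree k - 1; so this is a linear relation. *)
Definition connecting w mu U V k (x : set (form X k))
    (y : set (form X k.+1)) :=
  exists eta, [/\ closed_forms (fun p => w p * mu p) (U `&` V) eta,
    x = coset (H_space (fun p => w p * mu p) (U `&` V) k) eta
    & connecting_form w mu U V eta y].

End weighted_cohomology.

(* Main.v *)
Require Import Defs.
From mathcomp Require Import all_boot all_order all_algebra.
From mathcomp Require Import all_classical all_reals all_analysis.
From mathcomp Require Import measurable_realfun.
From mathcomp Require Import ring lra zify.

Set Implicit Arguments.
Unset Strict Implicit.
Unset Printing Implicit Defensive.

Import Order.TTheory GRing.Theory Num.Theory.
Import numFieldNormedType.Exports.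

Local Open Scope classical_set_scope.
Local Open Scope ring_scope.

(** Since the image of [d] is almost closed, a closed form of degree [k.+1] is zero
    in cohomology exactly when it is [d] of a form in the space C, so the exactness
    of the sequence of the spaces C yields the long exact sequence by a diagram
    chase.  The chase needs three local facts about the distributional [d]: it
    squares to zero (symmetry of second derivatives), the derivative of a form is
    unique up to null sets, and closed forms on [U] and on [V] which agree almost
    everywhere on [U `&` V] glue to a closed form on the union (smooth cutoffs). *)

(** * Alternating forms and the metric *)

(** A form is a plain function of the point, so equality comes in three strengths: pointwise on a
    set, almost everywhere as a function of the vectors ([ae_zero]), and almost everywhere for each
    coefficient in each chart ([chart_ae_eq]). Testing against smooth functions detects only the
    last, while the cosets of [C_space] use the second. These two do not transport measurability,
    since [vol] lives on the Borel sigma-algebra; hence local integrability has to be carried along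
    separately whenever a form is replaced by an almost everywhere equal one. Almost closedness
    speaks of degree [k.+1] only. In degree [k] the chase uses that [B_forms] is a subgroup
    containing the square integrable forms that vanish almost everywhere; this is enough because
    [eta = psiU - psiV] holds almost everywhere. The distributional [d] is tested in one chart at a
    time, so the cutoffs are built in R^n and no partition of unity on the manifold is involved. The
    norm of a form is a double sum against the inverse Gram matrix, whose nonnegativity is not
    visible; a Cholesky factor turns it into a sum of squares. *)

Section linear_algebra.
Variables (R : realType) (n : nat).

(** Induction on the size through the Schur complement of the first diagonal entry. Invertibility of
    the factor is what matters later: its inverse provides an orthonormal frame. *)
Lemma cholesky m (g : 'M[R]_m) : g^T = g ->
  (forall v : 'rV[R]_m, v != 0 -> 0 < (v *m g *m v^T) ord0 ord0) ->
  exists2 Q : 'M[R]_m, Q \in unitmx & g = Q *m Q^T.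
Proof.
elim: m g => [|m IH] g.
  by move=> _ _; exists 1%:M; rewrite ?unitmx1 // flatmx0 [RHS]flatmx0.
rewrite -[m.+1]/(1 + m)%N in g *.
rewrite -(submxK g).
set a := ulsubmx g; set b := ursubmx g; set b' := dlsubmx g; set D := drsubmx g.
rewrite tr_block_mx => /eq_block_mx[_ _ bE DE] pos.
have apos : 0 < a ord0 ord0.
  have := pos (row_mx 1%:M 0).
  rewrite mul_row_block tr_row_mx mul_row_col !mul0mx !mul1mx trmx1 trmx0 mulmx1 mulmx0 !addr0.
  apply; rewrite -row_mx0; apply/eqP => /eq_row_mx[/matrixP/(_ ord0 ord0)].
  by rewrite !mxE/=; move/eqP; rewrite oner_eq0.
pose t := a ord0 ord0.
have aE : a = t%:M by exact: mx11_scalar.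
have t0 : t != 0 by rewrite gt_eqF.
pose S := D - t^-1 *: (b^T *m b).
have [||q qu qE] := IH S.
- by rewrite /S linearB/= linearZ/= trmx_mul trmxK DE.
- move=> v v0.
  (* For given [v] this first coordinate minimises the quadratic form: the first block of the
     product vanishes and the value left is that of [S] at [v]. *)
  have := pos (row_mx (- t^-1 *: (v *m b^T)) v).
  rewrite mul_row_block tr_row_mx mul_row_col aE.
  have -> : - t^-1 *: (v *m b^T) *m t%:M + v *m b' = 0.
    by rewrite mul_mx_scalar scalerA mulrN mulfV // scaleN1r bE addNr.
  rewrite mul0mx add0r -scalemxAl -mulmxA.
  have -> : - t^-1 *: (v *m (b^T *m b)) + v *m D = v *m S.
    by rewrite /S mulmxBr -scalemxAr scaleNr addrC.
  apply; rewrite -row_mx0; apply/eqP => /eq_row_mx[_ v0'].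
  by rewrite v0' eqxx in v0.
pose r := Num.sqrt t.
have r0 : r != 0 by rewrite gt_eqF// sqrtr_gt0.
have rr : r * r = t by rewrite -expr2 sqr_sqrtr// ltW.
exists (block_mx r%:M 0 (r^-1 *: b^T) q).
  rewrite unitmxE det_lblock det_scalar1 unitrM -unitmxE qu andbT unitfE //.
rewrite tr_block_mx mulmx_block !trmx0 !mul0mx !mulmx0 !addr0.
rewrite tr_scalar_mx -scalar_mxM rr linearZ/= trmxK mul_scalar_mx mul_mx_scalar.
rewrite !scalerA mulfV// !scale1r.
rewrite -scalemxAl -scalemxAr scalerA -invfM rr -qE /S -bE addrC subrK aE.
by congr (block_mx _ _ _ _); rewrite -bE trmxK.
Qed.

Definition replace_row k (i : 'I_k) (v : 'rV[R]_n) (A : 'M[R]_(k, n)) :=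
  \matrix_(a, b) if a == i then v ord0 b else A a b.

Lemma row_replace k (i : 'I_k) v (A : 'M[R]_(k, n)) : row i (replace_row i v A) = v.
Proof. by apply/rowP => b; rewrite !mxE eqxx. Qed.

Lemma row'_replace k (i : 'I_k) v (A : 'M[R]_(k, n)) :
  row' i (replace_row i v A) = row' i A.
Proof. by apply/matrixP => a b; rewrite !mxE eq_sym (negbTE (neq_lift _ _)). Qed.

Lemma alternating_row k (f : 'M[R]_(k, n) -> R) (i : 'I_k) A : Defs.alternating f ->
  f A = \sum_j A i j * f (replace_row i (delta_mx ord0 j) A).
Proof.
move=> [lin _].
have linr b c u v : f (replace_row i (b *: u + c *: v) A) =
    b * f (replace_row i u A) + c * f (replace_row i v A).
  by apply: (lin _ _ _ i); rewrite ?row_replace ?row'_replace.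
have r0 : f (replace_row i 0 A) = 0.
  by have := linr 0 0 0 0; rewrite !scale0r addr0 !mul0r addr0.
have rS b u v : f (replace_row i (b *: u + v) A) =
    b * f (replace_row i u A) + f (replace_row i v A).
  by rewrite -{1}[v]scale1r linr mul1r.
have {1}-> : A = replace_row i (row i A) A.
  by apply/matrixP => a b; rewrite !mxE; case: eqP => // ->.
rewrite {1}[row i A]row_sum_delta.
have rSum (r : seq 'I_n) (F : 'I_n -> 'rV[R]_n) (G : 'I_n -> R) :
    f (replace_row i (\sum_(j <- r) G j *: F j) A) =
    \sum_(j <- r) G j * f (replace_row i (F j) A).
  by elim: r => [|j r IH]; rewrite ?big_nil ?r0// !big_cons rS IH.
by rewrite rSum; apply: eq_bigr => j _; rewrite mxE.
Qed.

Lemma alternating_expand k (f : 'M[R]_(k, n) -> R) A : Defs.alternating f ->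
  f A = \sum_(t : {ffun 'I_k -> 'I_n}) (\prod_a A a (t a)) * f (frame R t).
Proof.
move=> fa.
(* Induction on the number [m] of rows which are not yet standard basis vectors. *)
suff H m : (m <= k)%N -> forall (A : 'M[R]_(k, n)) (t0 : {ffun 'I_k -> 'I_n}),
    (forall a : 'I_k, (m <= a)%N -> row a A = delta_mx ord0 (t0 a)) ->
    f A = \sum_(t : {ffun 'I_k -> 'I_n}) (\prod_a A a (t a)) * f (frame R t).
  (* [H] asks for some [t0], which is immediate when [n] is positive. For [n = 0], either [k = 0]
     and [t0] is the empty function, or both sides are empty sums. *)
  case: (posnP n) => [n0|n0]; last first.
    apply: (H k (leqnn k) A [ffun=> Ordinal n0]) => a.
    by rewrite leqNgt ltn_ord.
  case: k f fa A H => [|k] f fa A H.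
    pose t0 : {ffun 'I_0 -> 'I_n} :=
      [ffun x : 'I_0 => match x with Ordinal _ h => False_rect _ (notF h) end].
    by apply: (H 0%N isT A t0) => -[].
  have E (t : {ffun 'I_k.+1 -> 'I_n}) : False by case: (t ord0) => m; rewrite n0.
  rewrite (alternating_row ord0 A fa) big1; last first.
    by move=> j; exfalso; case: j => m; rewrite n0.
  by rewrite big1// => t; case: (E t).
elim: m => [|m IH] mk {}A t0 At.
  have -> : A = frame R t0.
    by apply/matrixP => a b; have /rowP/(_ b) := At a isT; rewrite !mxE eqxx.
  rewrite (bigD1 t0)//= big1 ?mul1r; last by move=> a _; rewrite mxE eqxx.
  rewrite big1 ?addr0// => t /eqP tt0; suff [a ta] : exists a, t a != t0 a.
    by rewrite (bigD1 a)//= mxE (negbTE ta) !mul0r.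
  by apply/existsP; apply: contra_notT tt0 => /existsPn H; apply/ffunP => a; apply/eqP/negPn/H.
pose i := Ordinal mk.
rewrite (alternating_row i A fa).
under eq_bigr => j _.
  rewrite (IH (ltnW mk) _ [ffun a => if a == i then j else t0 a]); last first.
    move=> a ma; rewrite ffunE; case: eqVneq => [->|ai]; first exact: row_replace.
    rewrite -At; last by rewrite ltn_neqAle ma andbT eq_sym.
    by apply/rowP => b; rewrite !mxE (negbTE ai).
  rewrite mulr_sumr; over.
rewrite exchange_big/=; apply: eq_bigr => t _.
(* Row [i] is now the basis vector of index [j], so only [j = t i] contributes. *)
rewrite (bigD1 (t i))//= [X in _ + X]big1 ?addr0; last first.
  move=> j jt; rewrite (bigD1 i)//= !mxE !eqxx/= eq_sym (negbTE jt).
  by rewrite !mul0r mulr0.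
rewrite mulrA; congr (_ * _); rewrite [RHS](bigD1 i)//=; congr (_ * _).
rewrite (bigD1 i)//= !mxE !eqxx mul1r; apply: eq_bigr => a ai.
by rewrite !mxE (negbTE ai).
Qed.

Lemma frame_mul k (s : {ffun 'I_k -> 'I_n}) (C : 'M[R]_n) a b :
  (frame R s *m C) a b = C (s a) b.
Proof.
rewrite mxE (bigD1 (s a))//= mxE eqxx mul1r big1 ?addr0// => j js.
by rewrite mxE (negbTE js) mul0r.
Qed.

Lemma alternatingD k (f h : 'M[R]_(k, n) -> R) :
  Defs.alternating f -> Defs.alternating h -> Defs.alternating (f + h).
Proof.
move=> [fl fa] [hl ha]; split => [A B C i b c H1 H2 H3|A i j ij e] /=.
  by rewrite !fctE (fl A B C i b c)// (hl A B C i b c)//; ring.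
by rewrite fctE (fa _ _ _ ij)// (ha _ _ _ ij)// addr0.
Qed.

Lemma alternatingN k (f : 'M[R]_(k, n) -> R) : Defs.alternating f -> Defs.alternating (- f).
Proof.
move=> [fl fa]; split => [A B C i b c H1 H2 H3|A i j ij e] /=.
  by rewrite !fctE (fl A B C i b c)//; ring.
by rewrite fctE (fa _ _ _ ij)// oppr0.
Qed.

Lemma alternating0 k : Defs.alternating (0 : 'M[R]_(k, n) -> R).
Proof.
by split => [A B C i b c _ _ _|//]; rewrite /= !mulr0 addr0.
Qed.

Lemma alternating_mulmxr k (f : 'M[R]_(k, n) -> R) (P : 'M[R]_n) :
  Defs.alternating f -> Defs.alternating (fun v => f (v *m P)).
Proof.
move=> [fl fa]; split => [A B C i b c H1 H2 H3|A i j ij e] /=.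
  apply: (fl _ _ _ i).
  - by rewrite !row_mul H1 mulmxDl !scalemxAl.
  - apply/matrixP => x y; move/matrixP: H2 => H2; rewrite !mxE.
    by apply: eq_bigr => z _; have := H2 x z; rewrite !mxE => ->.
  - apply/matrixP => x y; move/matrixP: H3 => H3; rewrite !mxE.
    by apply: eq_bigr => z _; have := H3 x z; rewrite !mxE => ->.
by apply: (fa _ _ _ ij); rewrite !row_mul e.
Qed.

(* The rows of [invmx Q] are an orthonormal basis for [Q *m Q^T], so the norm
   becomes a sum of squares. *)
Lemma form_normsq_cholesky k (Q : 'M[R]_n) (f : 'M[R]_(k, n) -> R) :
  Q \in unitmx -> Defs.alternating f ->
  form_normsq (Q *m Q^T) f =
  (k`!%:R)^-1 * \sum_(u : {ffun 'I_k -> 'I_n}) f (frame R u *m invmx Q) ^+ 2.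
Proof.
move=> Qu fa; rewrite /form_normsq; congr (_ * _).
have -> : invmx (Q *m Q^T) = (invmx Q)^T *m invmx Q.
  have Qtu : Q^T \in unitmx by rewrite unitmx_tr.
  have QQ : Q *m Q^T \in unitmx by rewrite unitmx_mul Qu.
  apply: (can_inj (mulKmx QQ)); rewrite mulmxV// mulmxA -(mulmxA Q).
  by rewrite -trmx_mul mulVmx// trmx1 mulmx1 mulmxV.
set P := invmx Q.
(* Distributing the product over [a] collects the inner summation indices of [P^T *m P] into a
   function [u]; for fixed [u] the double sum over [s] and [t] is then a square. *)
have PP (s t : {ffun 'I_k -> 'I_n}) : \prod_a (P^T *m P) (s a) (t a) =
    \sum_(u : {ffun 'I_k -> 'I_n})
     (\prod_a P (u a) (s a)) * (\prod_a P (u a) (t a)).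
  under eq_bigr => a _ do (rewrite mxE; under eq_bigr => j _ do rewrite mxE).
  rewrite bigA_distr_bigA; apply: eq_bigr => u _.
  by rewrite -big_split.
under eq_bigr => s _ do under eq_bigr => t _ do rewrite PP 2!mulr_suml.
under eq_bigr => s _ do rewrite exchange_big/=.
rewrite exchange_big; apply: eq_bigr => u _.
rewrite (alternating_expand _ fa).
under [X in _ = X ^+ 2]eq_bigr => t _ do under eq_bigr => a _ do rewrite frame_mul.
rewrite expr2 mulr_suml; apply: eq_bigr => s _.
rewrite mulr_sumr; apply: eq_bigr => t _; ring.
Qed.

Definition pos_def (g : 'M[R]_n) := g^T = g /\
  forall v : 'rV[R]_n, v != 0 -> 0 < (v *m g *m v^T) ord0 ord0.

Lemma form_normsq_ge0 k (g : 'M[R]_n) (f : 'M[R]_(k, n) -> R) : pos_def g ->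
  Defs.alternating f -> 0 <= form_normsq g f.
Proof.
move=> [gs gp] fa; have [Q Qu ->] := cholesky gs gp.
rewrite form_normsq_cholesky// mulr_ge0// ?invr_ge0//.
by apply: sumr_ge0 => u _; rewrite sqr_ge0.
Qed.

(** If [Q] is a factor of [g], then [C *m Q] is a factor of the transformed metric, and [C] carries
    the orthonormal frame [invmx (C *m Q)] to [invmx Q]. *)
Lemma form_normsq_change k (g C : 'M[R]_n) (f : 'M[R]_(k, n) -> R) : pos_def g ->
  C \in unitmx -> Defs.alternating f ->
  form_normsq (C *m g *m C^T) (fun v => f (v *m C)) = form_normsq g f.
Proof.
move=> [gs gp] Cu fa; have [Q Qu ->] := cholesky gs gp.
have -> : C *m (Q *m Q^T) *m C^T = (C *m Q) *m (C *m Q)^T.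
  by rewrite trmx_mul !mulmxA.
have CQu : C *m Q \in unitmx by rewrite unitmx_mul Cu.
rewrite !form_normsq_cholesky//; last exact: alternating_mulmxr.
congr (_ * _); apply: eq_bigr => u _; congr (f _ ^+ 2).
rewrite -mulmxA; congr (_ *m _).
apply: (can_inj (mulKmx Qu)); rewrite mulmxV//.
apply: (can_inj (mulKmx Cu)); rewrite mulmx1.
by rewrite !mulmxA mulmxV// mul1mx.
Qed.

(** The parallelogram inequality in each orthonormal component. The factor 2 is harmless, as only
    finiteness and closures are at stake. *)
Lemma form_normsqD k (g : 'M[R]_n) (f h : 'M[R]_(k, n) -> R) : pos_def g ->
  Defs.alternating f -> Defs.alternating h ->
  form_normsq g (f + h) <= 2 * form_normsq g f + 2 * form_normsq g h.
Proof.
move=> [gs gp] fa ha; have [Q Qu ->] := cholesky gs gp.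
have fha := alternatingD fa ha.
rewrite !form_normsq_cholesky// (mulrCA 2) [X in _ <= _ + X]mulrCA -mulrDr.
apply: ler_wpM2l; first by rewrite invr_ge0.
rewrite !mulr_sumr -big_split/=; apply: ler_sum => u _.
rewrite fctE -subr_ge0.
have -> (x y : R) : 2 * x ^+ 2 + 2 * y ^+ 2 - (x + y) ^+ 2 = (x - y) ^+ 2 by ring.
exact: sqr_ge0.
Qed.

Lemma form_normsqN k (g : 'M[R]_n) (f : 'M[R]_(k, n) -> R) :
  form_normsq g (- f) = form_normsq g f.
Proof.
rewrite /form_normsq; congr (_ * _); apply: eq_bigr => s _; apply: eq_bigr => t _.
by rewrite !fctE; ring.
Qed.

Lemma form_normsq0 k (g : 'M[R]_n) : form_normsq g (0 : 'M[R]_(k, n) -> R) = 0.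
Proof.
by rewrite /form_normsq big1 ?mulr0// => s _; rewrite big1// => t _; rewrite !mulr0.
Qed.

End linear_algebra.

(** * Smooth functions and cutoffs *)

Section flat_functions.
Variable R : realType.
Implicit Types (P Q : {poly R}) (t : R).

(* The functions P(1/t) exp(-1/t), extended by 0, are closed under
   differentiation. *)
Definition flat P t : R := if 0 < t then P.[t^-1] * expR (- t^-1) else 0.

(** With [u = 1/t >= 1] and [N = size P], the polynomial is at most [S * u^N], while [exp u] is at
    least [u^(N+1) / (N+1)!]; one factor [t] is left over. *)
Lemma flat_bound P : exists C : R, forall t, 0 < t -> t <= 1 -> `|flat P t| <= C * t.
Proof.
pose S := \sum_(i < size P) `|P`_i|.
exists (S * (size P).+1`!%:R) => t t0 t1; rewrite /flat t0 normrM (ger0_norm (expR_ge0 _)).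
have u1 : 1 <= t^-1 by rewrite invf_ge1.
have u0 : 0 <= t^-1 by rewrite invr_ge0 ltW.
have H1 : `|P.[t^-1]| <= S * t^-1 ^+ size P.
  rewrite horner_coef (le_trans (ler_norm_sum _ _ _))// mulr_suml ler_sum// => i _.
  rewrite normrM ler_wpM2l// normrX (ger0_norm u0).
  by rewrite ler_weXn2l// ltnW.
have H2 : t^-1 ^+ (size P).+1 / (size P).+1`!%:R <= expR t^-1.
  by apply: (le_trans _ (expR_ge1Dxn (size P) u0)); rewrite lerDr.
have fp : 0 < (size P).+1`!%:R :> R by rewrite ltr0n fact_gt0.
rewrite expRN ler_pdivrMr ?expR_gt0//.
apply: (le_trans H1); rewrite -!mulrA ler_wpM2l ?sumr_ge0//.
move: H2; rewrite ler_pdivrMr// exprS => H2.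
rewrite -(ler_pM2l (_ : 0 < t^-1)) ?invr_gt0//.
apply: (le_trans H2); rewrite mulrCA mulKf ?gt_eqF// mulrC//.
Qed.

Lemma is_derive_flat P t : is_derive t 1 (flat P) (flat ('X^2 * (P^`() - P)%R * (-1)%:P) t).
Proof.
case: (ltgtP t 0) => [t0|t0|->].
- rewrite {2}/flat ltNge (ltW t0)/=.
  apply: (@near_eq_is_derive _ _ _ (cst (0 : R))).
  have : \forall x \near t, x < 0 by apply: lt_nbhsl.
  by apply: filterS => x x0; rewrite /flat ltNge (ltW x0).
- rewrite {2}/flat t0.
  apply: (@near_eq_is_derive _ _ _
    ((horner P \o (fun t => t^-1)) * (expR \o (fun t => - t^-1)))).
    have : \forall x \near t, 0 < x by apply: lt_nbhsr.
    by apply: filterS => x x0; rewrite /flat x0.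
  have iV : is_derive t 1 (fun t : R => t^-1) (- t ^- 2).
    apply: is_derive_eq; first by apply: (@is_deriveV _ id) => //; rewrite gt_eqF.
    by rewrite /GRing.scale/= mulr1.
  have d1 := is_derive1_comp (is_derive_poly P t^-1) iV.
  have d2 := @is_derive1_comp _ expR (fun t => - t^-1) t _ _
    (is_derive_expR (- t^-1)) (is_deriveN iV).
  apply: is_derive_eq.
  rewrite !hornerE /= /GRing.scale/= -exprVn; ring.
- rewrite {2}/flat ltxx.
  (* At 0 the difference quotient [flat P h / h] is [flat ('X * P) h] for positive [h], hence
     [O(h)]. *)
  have [C HC] := flat_bound ('X * P).
  have H : (fun h : R => h^-1 *: (flat P (h *: (1 : R) + 0) - flat P 0)) @ 0^' --> (0 : R).
    have C0 : 0 <= C.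
      by have := HC 1 ltr01 (lexx _); rewrite mulr1; apply: le_trans.
    apply/cvgr0Pnorm_lt => e e0; near=> h.
    rewrite /GRing.scale/= mulr1 addr0 {2}/flat ltxx subr0 /flat.
    have [h0|h0] := ltP 0 h; last by rewrite mulr0 normr0.
    have h1 : h <= 1.
      near: h; apply: nbhs_dnbhs.
      by apply: filterS (lt_nbhsl (ltr01 : 0 < (1 : R))) => x x1; exact: ltW.
    have := HC h h0 h1; rewrite /flat h0 !hornerE  => Hh.
    apply: (le_lt_trans Hh); rewrite (@le_lt_trans _ _ ((C + 1) * h))//.
      by rewrite ler_wpM2r ?lerDl// ltW.
    rewrite mulrC -ltr_pdivlMr ?ltr_wpDl//.
    near: h; apply: nbhs_dnbhs; apply: lt_nbhsl; rewrite divr_gt0// ltr_wpDl//.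
  apply: DeriveDef; first by apply/cvg_ex; exists 0; exact: H.
  by apply/cvg_lim => //; exact: H.
Unshelve. all: by end_near. Qed.

End flat_functions.

(** * Symmetry of second derivatives *)

Section schwarz.
Variables (R : realType) (V : normedModType R).
Implicit Types (f : V -> R) (x u v : V) (h : R).

Lemma eq_approx (a b : R) :
  (forall e : R, 0 < e -> exists2 p : R, `|p - a| < e & `|p - b| < e) -> a = b.
Proof.
move=> H; apply/eqP; rewrite -subr_eq0 -normr_le0 leNgt; apply/negP => e0.
have [p X1 X2] := H _ (divr_gt0 e0 (ltr0n _ 2)).
have : `|a - b| < `|a - b| / 2 + `|a - b| / 2.
  apply: le_lt_trans (ltrD X1 X2); rewrite (distrC p).
  by rewrite -(subrKA p) ler_normD.
by rewrite -splitr ltxx.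
Qed.

Lemma is_derive_line f x u t : differentiable f (x + t *: u) ->
  is_derive t 1 (fun t : R => f (x + t *: u)) ('D_u f (x + t *: u)).
Proof.
move=> df.
have fE : (fun h : R => h^-1 *:
      ((fun t : R => f (x + t *: u)) (h *: (1 : R) + t) - f (x + t *: u)))
    = (fun h => h^-1 *: (f (h *: u + (x + t *: u)) - f (x + t *: u))).
  apply/funext => h; congr (_ *: (f _ - _)).
  by rewrite scalerDl addrCA; congr (_ + (_ + _)); rewrite /GRing.scale/= mulr1.
apply: DeriveDef.
  rewrite /derivable; rewrite fE; exact: diff_derivable.
by rewrite /derive fE.
Qed.

Lemma mvt_line f x u h : (forall y, differentiable f y) -> 0 < h ->
  exists2 c : R, 0 < c < h & f (x + h *: u) - f x = h * 'D_u f (x + c *: u).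
Proof.
move=> df h0.
have [||c] := @MVT _ (fun t : R => f (x + t *: u)) (fun t => 'D_u f (x + t *: u)) _ _ h0.
- by move=> t _; exact: is_derive_line.
- apply: continuous_subspaceT => t; apply/differentiable_continuous/derivable1_diffP.
  by have [] := is_derive_line (df (x + t *: u)).
- rewrite in_itv/= => ch; rewrite scale0r addr0 subr0 mulrC => e.
  by exists c.
Qed.

(* For small [h] the second difference is [h ^+ 2] times either mixed derivative
   at a nearby point. *)
Lemma second_difference f x u v h : (forall y, differentiable f y) ->
  (forall y, differentiable ('D_u f) y) -> 0 < h ->
  exists c d : R, [/\ 0 < c < h, 0 < d < h &
  f (x + h *: u + h *: v) - f (x + h *: u) - f (x + h *: v) + f x =
  h ^+ 2 * 'D_v ('D_u f) (x + c *: u + d *: v)].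
Proof.
move=> df ddf h0.
(* Mean value theorem along [u] for the increment [F] in direction [v], then along [v] for
   ['D_u f]. *)
pose F y := f (y + h *: v) - f y.
have dshift y : differentiable (fun y => f (y + h *: v)) y.
  by apply: (@differentiable_comp _ _ _ _ (fun y => y + h *: v) f).
have dF y : differentiable F y by exact: differentiableB.
have [c ch e] := mvt_line x u dF h0.
have FE : 'D_u F (x + c *: u) = 'D_u f (x + c *: u + h *: v) - 'D_u f (x + c *: u).
  rewrite deriveB; [|exact: diff_derivable|exact: diff_derivable].
  congr (_ - _); rewrite /derive.
  apply: (congr1 (fun G => lim (G @ 0^'))); apply/funext => t /=.
  by congr (_ *: (f _ - _)); rewrite -addrA.
have [d dh e'] := mvt_line (x + c *: u) v ddf h0.
exists c, d; split => //.
rewrite expr2 -mulrA -e' -FE -e /F; ring.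
Qed.

(** The second difference is symmetric in [u] and [v]; expanding it in both orders equates the two
    mixed derivatives at points that tend to [x] with [h], and continuity concludes. *)
Lemma schwarz f x u v : (forall y, differentiable f y) ->
  (forall y, differentiable ('D_u f) y) -> (forall y, differentiable ('D_v f) y) ->
  {for x, continuous ('D_v ('D_u f))} -> {for x, continuous ('D_u ('D_v f))} ->
  'D_v ('D_u f) x = 'D_u ('D_v f) x.
Proof.
move=> df du dv cu cv.
have lim0 (g : V -> R) (a b : V) (e : R) : {for x, continuous g} -> 0 < e ->
   exists2 r : R, 0 < r & forall h : R, 0 < h < r -> forall c d : R, 0 < c < h -> 0 < d < h ->
      `|g (x + c *: a + d *: b) - g x| < e.
  move=> cg e0; have /cvgr_dist_lt/(_ _ e0) := cg.
  move=> /nbhs_ballP[r /= r0 br].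
  (* The [+ 1] keeps the denominator positive when [a] and [b] both vanish. *)
  have ab0 : 0 < `|a| + `|b| + 1 by rewrite ltr_wpDl// addr_ge0.
  exists (r / (`|a| + `|b| + 1)); first exact: divr_gt0.
  move=> h /andP[h0 hr] c d /andP[c0 ch] /andP[d0 dh].
  rewrite distrC; apply: br; rewrite -ball_normE/= -addrA opprD addNKr normrN.
  apply: (le_lt_trans (ler_normD _ _)); rewrite !normrZ !gtr0_norm//.
  apply: (@le_lt_trans _ _ (h * (`|a| + `|b|))).
    by rewrite mulrDr lerD// ler_wpM2r// ltW.
  apply: (@le_lt_trans _ _ (h * (`|a| + `|b| + 1))).
    by rewrite ler_wpM2l ?lerDl// ltW.
  by rewrite -ltr_pdivlMr.
apply: eq_approx => e e20.
have [r1 r10 H1] := lim0 _ u v _ cu e20; have [r2 r20 H2] := lim0 _ v u _ cv e20.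
pose h : R := Num.min r1 r2 / 2.
have m0 : 0 < Num.min r1 r2 by rewrite lt_min r10.
have h0 : 0 < h by rewrite divr_gt0.
have hm : h < Num.min r1 r2 by rewrite ltr_pdivrMr// ltr_pMr// ltr1n.
have Hu := H1 h; have Hv := H2 h.
rewrite h0 (lt_le_trans hm) ?ge_min ?lexx// in Hu.
rewrite h0 (lt_le_trans hm) ?ge_min ?lexx ?orbT// in Hv.
have [c [d [ch dh e1]]] := second_difference x v df du h0.
have [c' [d' [ch' dh' e2]]] := second_difference x u df dv h0.
have E : 'D_v ('D_u f) (x + c *: u + d *: v) = 'D_u ('D_v f) (x + c' *: v + d' *: u).
  have aux (a a' b c0 d0 : R) : a = a' -> a - b - c0 + d0 = a' - c0 - b + d0.
    by move=> ->; rewrite (addrAC a').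
  have hh : h ^+ 2 != 0 by rewrite sqrf_eq0 gt_eqF.
  apply: (mulfI hh); apply: etrans (esym e1) _; apply: etrans _ e2.
  by apply: aux; congr f; exact: addrAC.
have X1 := Hu isT _ _ ch dh; have X2 := Hv isT _ _ ch' dh'.
rewrite E in X1; by exists ('D_u ('D_v f) (x + c' *: v + d' *: u)).
Qed.

End schwarz.

(** * Algebra of smooth functions on R^n *)

Section smooth.
Variables (R : realType) (n : nat).
Local Notation E := 'rV[R]_n.
Implicit Types (f g : E -> R).

(* A class of differentiable functions which is closed under [partial j]
   consists of smooth functions. *)
Inductive smooth_class : (E -> R) -> Prop :=
| SmoothBase f : smooth_on setT f -> smooth_class f
| SmoothCst (c : R) : smooth_class (cst c)
| SmoothCoord (j : 'I_n) : smooth_class (fun x => x ord0 j)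
| SmoothAdd f g : smooth_class f -> smooth_class g -> smooth_class (f + g)
| SmoothMul f g : smooth_class f -> smooth_class g -> smooth_class (f * g)
| SmoothFlat P f : smooth_class f -> smooth_class (flat P \o f).

Lemma smooth_partial (O : set E) j f : smooth_on O f -> smooth_on O (partial j f).
Proof. by move=> sf s x Ox; have := sf (rcons s j) x Ox; rewrite foldr_rcons. Qed.

Lemma differentiable_flat (P : {poly R}) t : differentiable (flat P) t.
Proof. by apply/derivable1_diffP; have [] := is_derive_flat P t. Qed.

Lemma smooth_class_diff f : smooth_class f -> forall x, differentiable f x.
Proof.
elim=> {f} [f fs|c|j|f g _ IHf _ IHg|f g _ IHf _ IHg|P f _ IHf] x.
- exact: (fs [::]).
- exact: differentiable_cst.
- exact: differentiable_coord.
- exact: differentiableD.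
- exact: differentiableM.
- exact/differentiable_comp/differentiable_flat.
Qed.

Lemma smooth_class_partial j f : smooth_class f -> smooth_class (partial j f).
Proof.
elim=> {f} [f fs|c|i|f g sf IHf sg IHg|f g sf IHf sg IHg|P f sf IHf].
- exact/SmoothBase/smooth_partial.
- suff -> : partial j (cst c) = cst (0 : R) by exact: SmoothCst.
  by apply/funext => x; rewrite /partial derive_cst.
- suff -> : partial j (fun x => x ord0 i) = cst ((j == i)%:R : R) by exact: SmoothCst.
  apply/funext => x; rewrite /partial /derive /=; apply/cvg_lim => //.
  apply: cvg_near_cst; rewrite /dnbhs; near=> h; rewrite !mxE eqxx/= addrK eq_sym.
  rewrite /GRing.scale/= mulKf//; near: h; exact: nbhs_dnbhs_neq.
- suff -> : partial j (f + g) = partial j f + partial j g by exact: SmoothAdd.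
  by apply/funext => x; apply: deriveD;
    exact/diff_derivable/smooth_class_diff.
- suff -> : partial j (f * g) = f * partial j g + g * partial j f.
    by apply: SmoothAdd; exact: SmoothMul.
  by apply/funext => x; apply: deriveM;
    exact/diff_derivable/smooth_class_diff.
- pose Q : {poly R} := 'X^2 * (P^`() - P)%R * (-1)%:P.
  suff -> : partial j (flat P \o f) = (flat Q \o f) * partial j f.
    by apply: SmoothMul => //; exact: SmoothFlat.
  have dP t : derive1 (flat P) t = flat Q t by rewrite derive1E; have [] := is_derive_flat P t.
  apply/funext => x; rewrite /partial deriveE; last first.
    exact/differentiable_comp/differentiable_flat/smooth_class_diff.
  rewrite diff_comp; [|exact: smooth_class_diff|exact: differentiable_flat].
  rewrite /= diff1E; last exact: differentiable_flat.
  rewrite dP -deriveE; last exact: smooth_class_diff.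
  exact: mulrC.
Unshelve. all: by end_near. Qed.

Lemma smooth_class_smooth f : smooth_class f -> smooth_on setT f.
Proof.
move=> sf s x _; apply: smooth_class_diff.
by elim: s => //= j s; exact: smooth_class_partial.
Qed.

Lemma smoothD f g : smooth_on setT f -> smooth_on setT g -> smooth_on setT (f + g).
Proof. by move=> sf sg; apply/smooth_class_smooth/SmoothAdd; exact: SmoothBase. Qed.

Lemma smoothM f g : smooth_on setT f -> smooth_on setT g -> smooth_on setT (f * g).
Proof. by move=> sf sg; apply/smooth_class_smooth/SmoothMul; exact: SmoothBase. Qed.

Lemma smooth_cst (c : R) : smooth_on setT (cst c : E -> R).
Proof. exact/smooth_class_smooth/SmoothCst. Qed.

Lemma smooth_coord (j : 'I_n) : smooth_on setT (fun x : E => x ord0 j).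
Proof. exact/smooth_class_smooth/SmoothCoord. Qed.

Lemma smooth_flat (P : {poly R}) f : smooth_on setT f -> smooth_on setT (flat P \o f).
Proof. by move=> sf; apply/smooth_class_smooth/SmoothFlat/SmoothBase. Qed.

Lemma smooth_prod (I : Type) (r : seq I) (F : I -> E -> R) :
  (forall i, smooth_on setT (F i)) -> smooth_on setT (fun x => \prod_(i <- r) F i x).
Proof.
move=> sF; elim: r => [|i r IH].
  rewrite (_ : (fun _ => _) = cst 1); first exact: smooth_cst.
  by apply/funext => x; rewrite big_nil.
rewrite (_ : (fun _ => _) = F i * (fun x => \prod_(i <- r) F i x)); first exact: smoothM.
by apply/funext => x; rewrite big_cons.
Qed.

Lemma partial_comm f i j : smooth_on setT f ->
  partial i (partial j f) = partial j (partial i f).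
Proof.
move=> sf; apply/funext => x; apply: schwarz.
- by move=> y; exact: (sf [::]).
- by move=> y; exact: (sf [:: j]).
- by move=> y; exact: (sf [:: i]).
- exact: (differentiable_continuous (sf [:: i; j] x I)).
- exact: (differentiable_continuous (sf [:: j; i] x I)).
Qed.

End smooth.

(** * Smooth cutoffs *)

Section cutoff.
Variables (R : realType).

(* 0 for t <= 0 and 1 for t >= 1.  A composition of flat functions, rather than
   the usual quotient flat t / (flat t + flat (1 - t)), stays in
   [smooth_class]. *)
Definition smooth_step (t : R) : R :=
  flat 1 (expR (-1) - flat 1 (1 - t)) / flat 1 (expR (-1)).

Lemma flat1_ge0 (t : R) : 0 <= flat 1 t.
Proof. by rewrite /flat; case: ifP => // _; rewrite hornerC mul1r expR_ge0. Qed.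

Lemma flat1_gt0 (t : R) : 0 < t -> 0 < flat 1 t.
Proof. by move=> t0; rewrite /flat t0 hornerC mul1r expR_gt0. Qed.

Lemma flat1_le (s t : R) : s <= t -> flat 1 s <= flat 1 t.
Proof.
move=> st; have [s0|s0] := ltP 0 s; last by rewrite {1}/flat ltNge s0 flat1_ge0.
have t0 := lt_le_trans s0 st.
rewrite /flat s0 t0 !hornerC !mul1r ler_expR lerN2 lef_pV2//.
Qed.

(** The constant [expR (-1)] is the value [flat 1 1]: by monotonicity the outer flat function is
    evaluated at a nonpositive number as soon as [1 - t >= 1]. *)
Lemma smooth_step0 (t : R) : t <= 0 -> smooth_step t = 0.
Proof.
move=> t0; rewrite /smooth_step {1}/flat ltNge.
suff -> : expR (-1) - flat 1 (1 - t) <= 0 by rewrite mul0r.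
rewrite subr_le0.
suff <- : flat 1 (1 : R) = expR (-1) by apply: flat1_le; rewrite lerBrDr gerDl.
by rewrite /flat ltr01 invr1 hornerC mul1r.
Qed.

Lemma smooth_step1 (t : R) : 1 <= t -> smooth_step t = 1.
Proof.
move=> t1; rewrite /smooth_step {2}/flat ltNge subr_le0 t1/= subr0 divff//.
by rewrite gt_eqF// flat1_gt0// expR_gt0.
Qed.

Lemma smooth_step01 (t : R) : 0 <= smooth_step t <= 1.
Proof.
have c0 : 0 < flat 1 (expR (-1) : R) by rewrite flat1_gt0// expR_gt0.
rewrite divr_ge0 ?flat1_ge0//= ler_pdivrMr// mul1r flat1_le//.
by rewrite lerBlDr lerDl flat1_ge0.
Qed.

Variable n : nat.
Local Notation E := 'rV[R]_n.

Lemma smooth_on_step (f : E -> R) : smooth_on setT f -> smooth_on setT (smooth_step \o f).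
Proof.
move=> sf.
have sN (g : E -> R) : smooth_on setT g -> smooth_on setT (cst (-1) * g).
  by move=> sg; apply: smoothM => //; exact: smooth_cst.
rewrite (_ : _ \o _ = (flat 1 \o (cst (expR (-1)) +
   cst (-1) * (flat 1 \o (cst 1 + cst (-1) * f)))) * cst (flat 1 (expR (-1)))^-1).
  apply: smoothM; last exact: smooth_cst.
  apply: smooth_flat; apply: smoothD; first exact: smooth_cst.
  apply/sN/smooth_flat/smoothD; first exact: smooth_cst.
  exact: sN.
by apply/funext => x; rewrite /smooth_step /= !fctE /= !mulN1r.
Qed.

Lemma norm_rV_le (x : E) (r : R) : 0 <= r ->
  (`|x| <= r) <-> (forall j, `|x ord0 j| <= r).
Proof.
move=> r0; rewrite {1}/Num.norm/= mx_normrE; split.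
  by move=> /bigmax_leP[_ H] j; exact: (H (ord0, j)).
move=> H; apply/bigmax_leP; split => //= -[i j] _ /=; rewrite ord1; exact: H.
Qed.

(* 1 where |x - a| <= r, and 0 where |x - a| > 2 r, in the sup norm of
   ['rV[R]_n]. *)
Definition plateau (a : E) (r : R) (x : E) : R :=
  \prod_(j < n) smooth_step (2 - ((x ord0 j - a ord0 j) / r) ^+ 2).

Lemma plateau_smooth a r : smooth_on setT (plateau a r).
Proof.
apply: smooth_prod => j; apply: smooth_on_step.
pose h : E -> R := cst r^-1 * ((fun x => x ord0 j) + cst (- a ord0 j)).
have sh : smooth_on setT h.
  apply: smoothM; first exact: smooth_cst.
  by apply: smoothD; [exact: smooth_coord|exact: smooth_cst].
rewrite (_ : (fun _ => _) = cst 2 + cst (-1) * (h * h)).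
  apply: smoothD; first exact: smooth_cst.
  apply: smoothM; first exact: smooth_cst.
  exact: smoothM.
apply/funext => x; rewrite /h !fctE /=; ring.
Qed.

Lemma plateau01 a r x : 0 <= plateau a r x <= 1.
Proof.
rewrite /plateau; elim/big_ind : _ => [|u v /andP[u0 u1] /andP[v0 v1]|j _].
- by rewrite ler01 lexx.
- by rewrite mulr_ge0// mulr_ile1.
- exact: smooth_step01.
Qed.

Lemma plateau1 a r x : 0 < r -> `|x - a| <= r -> plateau a r x = 1.
Proof.
move=> r0 /norm_rV_le H; rewrite /plateau big1// => j _; apply: smooth_step1.
have := H (ltW r0) j; rewrite !mxE => Hj.
have : `|(x ord0 j - a ord0 j) / r| <= 1.
  by rewrite normrM normfV (gtr0_norm r0) ler_pdivrMr// mul1r.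
set q : R := _ / r => q1.
have q2 : q ^+ 2 <= 1 by rewrite -real_normK ?num_real// expr_le1.
by rewrite lerBrDr addrC -lerBrDr (_ : 2 - 1 = 1)//; ring.
Qed.

Lemma plateau0 a r x : 0 < r -> 2 * r < `|x - a| -> plateau a r x = 0.
Proof.
move=> r0 xa.
have [j Hj] : exists j, 2 * r < `|x ord0 j - a ord0 j|.
  apply: contrapT => /forallNP H; move: xa; rewrite ltNge => /negP; apply.
  apply/norm_rV_le; first by rewrite mulr_ge0// ltW.
  by move=> j; rewrite !mxE leNgt; apply/negP/H.
rewrite /plateau (bigD1 j)//= smooth_step0 ?mul0r//.
have : 2 <= `|(x ord0 j - a ord0 j) / r|.
  by rewrite normrM normfV (gtr0_norm r0) ler_pdivlMr// ltW.
set q : R := _ / r => q1.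
(* The factor already vanishes for [|q|] at least the square root of 2; the radius [2 * r] is a
   rounding of that. *)
have q2 : 2 <= q ^+ 2.
  rewrite -real_normK ?num_real// (le_trans q1)// expr2 ler_peMl//.
  by rewrite (le_trans _ q1)// ler1n.
by rewrite subr_le0.
Qed.

Lemma closed_ball_rV_compact (a : E) (r : R) : compact [set x | `|x - a| <= r].
Proof.
apply: bounded_closed_compact.
  exists (`|a| + r); split; first exact: num_real.
  move=> M HM x /= xa; apply: (le_trans _ (ltW HM)).
  by rewrite -[x](subrK a) (le_trans (ler_normD _ _))// addrC lerD2l.
rewrite (_ : [set _ | _] = closed_ball_ Num.norm a r); first exact: closed_closed_ball_.
by apply/seteqP; split => x; rewrite /closed_ball_/= distrC.
Qed.

(** For a finite cover by plateaus, one minus the product of their complements is 1 where some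
    plateau is 1, is 0 where all vanish, and stays in [0, 1] without any normalisation. The
    neighbourhood [N] will keep the support of [(1 - chi) * f] away from [K]. *)
Lemma smooth_cutoff (K G : set E) : compact K -> open G -> K `<=` G ->
  exists chi : E -> R, exists N K' : set E, [/\ smooth_on setT chi,
    forall x, 0 <= chi x <= 1, [/\ open N, K `<=` N & forall x, N x -> chi x = 1],
    compact K' & K' `<=` G /\ forall x, ~ K' x -> chi x = 0].
Proof.
move=> cK oG KG.
(* The radius gets the dummy value 1 off [K], so that it is a total function of the centre. *)
have rG x : {r : R | 0 < r & K x -> [set y | `|y - x| <= 2 * r] `<=` G}.
  apply: cid2; case: (pselect (K x)) => [Kx|nKx]; last by exists 1.
  have /nbhs_ballP[e /= e0 eG] := open_nbhs_nbhs (conj oG (KG _ Kx)).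
  (* Since [2 / 3 < 1], the closed ball of radius [2 * (e / 3)] lies in the open ball of radius
     [e]. *)
  exists (e / 3); first exact: divr_gt0.
  move=> _ y /= yx; apply: eG; rewrite -ball_normE/= distrC.
  apply: (le_lt_trans yx); rewrite mulrCA gtr_pMr// ltr_pdivrMr// mul1r ltr_nat//.
pose r x := s2val (rG x).
have r0 x : 0 < r x by rewrite /r; case: (rG x).
have rGP x : K x -> [set y | `|y - x| <= 2 * r x] `<=` G by rewrite /r; case: (rG x).
have [D DK KD] : exists2 D : seq E, (forall a, a \in D -> K a) &
    forall x, K x -> exists2 a, a \in D & ball a (r a) x.
  have : cover_compact K by rewrite -compact_cover.
  move=> /(_ _ K (fun x => ball x (r x))) []; first by move=> x _; exact: ball_open.
    by move=> x Kx; exists x => //; exact: ballxx.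
  move=> D DK KD; exists (finmap.enum_fset D) => [a aD|x /KD[a aD xa]]; last by exists a.
  by have := DK a aD; rewrite inE.
exists (fun x => 1 - \prod_(a <- D) (1 - plateau a (r a) x)).
exists (\bigcup_(a in [set` D]) ball a (r a)).
exists (\big[setU/set0]_(a <- D) [set y | `|y - a| <= 2 * r a]).
split.
- rewrite (_ : (fun _ => _) =
    cst 1 + cst (-1) * (fun x => \prod_(a <- D) (1 - plateau a (r a) x))).
    apply: smoothD; first exact: smooth_cst.
    apply: smoothM; first exact: smooth_cst.
    apply: smooth_prod => a.
    rewrite (_ : (fun _ => _) = cst 1 + cst (-1) * plateau a (r a)).
      apply: smoothD; first exact: smooth_cst.
      by apply: smoothM; [exact: smooth_cst|exact: plateau_smooth].
    by apply/funext => x; rewrite !fctE/= mulN1r.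
  by apply/funext => x; rewrite !fctE/= mulN1r.
- move=> x; suff /andP[p0 p1] : 0 <= \prod_(a <- D) (1 - plateau a (r a) x) <= 1.
    by rewrite subr_ge0 p1/= lerBlDr lerDl.
  elim/big_ind : _ => [|u v /andP[u0 u1] /andP[v0 v1]|a _].
  + by rewrite ler01 lexx.
  + by rewrite mulr_ge0// mulr_ile1.
  + by have /andP[p0 p1] := plateau01 a (r a) x; rewrite subr_ge0 p1/= lerBlDr lerDl.
- split.
  + by apply: bigcup_open => x _; exact: ball_open.
  + by move=> x /KD[a aD xa]; exists a.
  move=> x [a /= aD]; rewrite -ball_normE/= distrC => /ltW xa.
  by rewrite (big_rem a)//= plateau1// subrr mul0r subr0.
- apply: bigsetU_compact => a _; exact: closed_ball_rV_compact.
- split.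
    rewrite -bigcup_seq => x [a /= aD]; apply: rGP.
    exact: DK.
  move=> x; rewrite -bigcup_seq => xD.
  rewrite big_seq big1 ?subrr// => a aD; rewrite plateau0 ?subr0// ltNge.
  by apply/negP => xa; apply: xD; exists a.
Qed.

End cutoff.

Lemma closed_dist_ge (R : realType) (V : normedModType R) (y : V) (e : R) :
  closed [set x | e <= `|x - y|].
Proof.
rewrite (_ : [set _ | _] = (Num.norm \o (fun x => y - x)) @^-1` [set t | e <= t]); last first.
  by apply/seteqP; split => x /=; rewrite distrC.
apply: preimage_closed; last exact: closed_ge.
move=> x _; apply: (continuous_comp _ (@norm_continuous _ _ _)).
by apply: continuousB => //; exact: cvg_cst.
Qed.

(** * Test functions and compact subsets of R^n *)

Section test_functions.
Variables (R : realType) (n : nat).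
Local Notation E := 'rV[R]_n.
Implicit Types (f g : E -> R) (O : set E).

Lemma partial_outside (K : set E) f j x : compact K ->
  (forall y, ~ K y -> f y = 0) -> ~ K x -> partial j f x = 0.
Proof.
move=> cK f0 nKx; rewrite /partial -(derive_cst (0 : R) x (delta_mx ord0 j)).
apply: near_eq_derive.
have oK : open (~` K) by rewrite openC; apply: compact_closed => //; exact: norm_hausdorff.
by apply: filterS (open_nbhs_nbhs (conj oK nKx)) => y /f0.
Qed.

Lemma test_partial O f j : test_function O f -> test_function O (partial j f).
Proof.
move=> [sf [K [cK KO f0]]]; split; first exact: smooth_partial.
by exists K; split => // x; exact: partial_outside f0.
Qed.

Lemma test_function_sub O O' f : O `<=` O' -> test_function O f -> test_function O' f.
Proof.
move=> OO' [sf [K [cK KO f0]]]; split => //; exists K; split => //.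
exact: subset_trans KO OO'.
Qed.

Lemma smooth_diff f x : smooth_on setT f -> differentiable f x.
Proof. by move=> sf; exact: (sf [::] x I). Qed.

Lemma partialD f g j : smooth_on setT f -> smooth_on setT g ->
  partial j (f + g) = partial j f + partial j g.
Proof.
by move=> sf sg; apply/funext => x; apply: deriveD; exact/diff_derivable/smooth_diff.
Qed.

Lemma compact_setD (K N : set E) : compact K -> open N -> compact (K `\` N).
Proof.
move=> cK oN; apply: (subclosed_compact _ cK); last by move=> x [].
apply: closedI; last by rewrite closedC.
by apply: compact_closed => //; exact: norm_hausdorff.
Qed.

(** The part of the support [K] outside [O2] is a compact subset of [O1]. A cutoff [chi] equal to 1
    on a neighbourhood [N] of it leaves [(1 - chi) * f] supported in [K] minus [N], inside [O2]. *)
Lemma test_function_split (O1 O2 : set E) f : open O1 -> open O2 ->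
  test_function (O1 `|` O2) f ->
  exists f1 f2, [/\ test_function O1 f1, test_function O2 f2 & f = f1 + f2].
Proof.
move=> o1 o2 [sf [K [cK KO f0]]].
have K1O : K `\` O2 `<=` O1 by move=> x [/KO[]].
have [chi [N [K' [schi _ [oN KN N1] cK' [K'O chi0]]]]] :=
  smooth_cutoff (compact_setD cK o2) o1 K1O.
have s2 : smooth_on setT (cst 1 + cst (-1) * chi).
  apply: smoothD; first exact: smooth_cst.
  by apply: smoothM => //; exact: smooth_cst.
exists (chi * f), ((cst 1 + cst (-1) * chi) * f); split.
- split; first exact: smoothM.
  exists K'; split => // x /chi0 e.
  by rewrite fctE e mul0r.
- split; first exact: smoothM.
  exists (K `\` N); split; first exact: compact_setD.
    by move=> x [Kx nNx]; apply: contrapT => nO2; apply/nNx/KN.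
  move=> x nx; rewrite !fctE/=; case: (pselect (K x)) => [Kx|/f0->]; last by rewrite mulr0.
  rewrite N1 ?mulr1 ?subrr ?mul0r//.
  by apply: contrapT => nN; apply: nx.
- by apply/funext => x; rewrite !fctE/=; ring.
Qed.

(** The same cutoff gives the two pieces: [K] intersected with [K'], and [K] minus [N]. They cover
    [K] because [chi] is 1 on [N] and 0 off [K'], which forces [N] into [K']. *)
Lemma compact_split (K O1 O2 : set E) : compact K -> open O1 -> open O2 ->
  K `<=` O1 `|` O2 ->
  exists K1 K2, [/\ compact K1 /\ compact K2, K1 `<=` O1, K2 `<=` O2 & K = K1 `|` K2].
Proof.
move=> cK o1 o2 KO.
have K1O : K `\` O2 `<=` O1 by move=> x [/KO[]].
have [chi [N [K' [_ _ [oN KN N1] cK' [K'O chi0]]]]] :=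
  smooth_cutoff (compact_setD cK o2) o1 K1O.
have clK : closed K by apply: compact_closed => //; exact: norm_hausdorff.
exists (K `&` K'), (K `\` N); split.
- split; last exact: compact_setD.
  by rewrite setIC; exact: compact_closedI.
- by move=> x [_ /K'O].
- by move=> x [Kx nNx]; apply: contrapT => nO2; apply/nNx/KN.
- apply/seteqP; split => [x Kx|x [[]//|[]//]].
  case: (pselect (N x)) => Nx; [left|by right]; split => //.
  apply: contrapT => /chi0; rewrite N1// => /eqP; by rewrite oner_eq0.
Qed.

(** [F m] consists of the points of [K] at distance at least [1/(m+1)] from the complement of [G].
    Writing it as an intersection over that complement also covers the case where it is empty. *)
Lemma compact_exhaustion (G K : set E) : open G -> compact K -> G `<=` K ->
  exists F : nat -> set E, [/\ forall m, compact (F m), forall m, F m `<=` G &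
    forall x, G x -> \forall m \near \oo, F m x].
Proof.
move=> oG cK GK.
pose F m := K `&` \bigcap_(y in ~` G) [set x | (m.+1%:R)^-1 <= `|x - y|].
exists F; split.
- move=> m; apply: compact_closedI => //.
  by apply: closed_bigI => y _; exact: closed_dist_ge.
- move=> m x [_ Fx]; apply: contrapT => nGx; have /= := Fx x nGx.
  by rewrite subrr normr0 leNgt invr_gt0 ltr0n.
- move=> x Gx; have /nbhs_ballP[e /= e0 eG] := open_nbhs_nbhs (conj oG Gx).
  have [N HN] : exists N : nat, forall m, (N <= m)%N -> (m.+1%:R : R)^-1 <= e.
    exists (Num.truncn e^-1) => m Nm.
    rewrite -[leRHS]invrK lef_pV2 ?posrE ?invr_gt0//.
    rewrite (le_trans (ltW (truncnS_gt _)))// ler_nat//.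
  exists N => // m /= Nm; split; first exact: GK.
  move=> y nGy /=; rewrite (le_trans (HN _ Nm))// leNgt; apply/negP => xy.
  by apply: nGy; apply: eG; rewrite -ball_normE.
Qed.

End test_functions.
(** * Charts and Borel sets *)

Section borel.
Variables (T : ptopologicalType).

Lemma open_measurable_borel (U : set (borel T)) : @open T U -> measurable U.
Proof. by move=> oU; apply: sub_sigma_algebra. Qed.

Lemma compact_measurable_borel (K : set (borel T)) : hausdorff_space T ->
  @compact T K -> measurable K.
Proof.
move=> hT cK; rewrite -(setCK K); apply: measurableC; apply: open_measurable_borel.
by rewrite openC; exact: compact_closed.
Qed.

Lemma continuous_on_measurable (R : realType) (D : set T) (f : T -> R) : open D ->
  {in D, continuous f} -> measurable_fun (D : set (borel T)) (f : borel T -> R).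
Proof.
move=> oD cf; apply: (measurability (@RGenOInfty.G R)).
  exact: RGenOInfty.measurableE.
move=> _ [_ [x ->] <-]; apply: open_measurable_borel.
rewrite openE => p [Dp fp].
have : nbhs p D by exact: open_nbhs_nbhs.
have : nbhs p (f @^-1` `]x, +oo[).
  apply: (cf p); first exact: mem_set.
  exact: open_nbhs_nbhs.
by move=> H1 H2; apply: filterI.
Qed.

End borel.

(** The chain rule; with row vectors the Jacobian of a composite is the product in order of
    application. The identity is asked only near [x], because transition maps are meaningful only on
    chart images. *)
Lemma jacobian_inverse (R : realType) (n : nat) (F G : 'rV[R]_n -> 'rV[R]_n) x :
  differentiable F x -> differentiable G (F x) -> (\near x, G (F x) = x) ->
  jacobian F x *m jacobian G (F x) = 1%:M.
Proof.
move=> dF dG GFid.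
have dGF := differentiable_comp dF dG.
have did : differentiable (id : 'rV[R]_n -> 'rV[R]_n) x by [].
have E v : 'd G (F x) ('d F x v) = v.
  apply: etrans (esym (congr1 (fun f => f v) (diff_comp dF dG))) _.
  apply: etrans (esym (deriveE v dGF)) _.
  apply: etrans (@near_eq_derive _ _ _ _ id _ v GFid) _.
  exact: derive_id.
apply/row_matrixP => i; rewrite row_mul rowE /jacobian !mul_rV_lin1.
by rewrite E row1.
Qed.

(** * Charts, and measurability tested in charts *)

Section manifold.
Variables (R : realType) (M : smoothManifold R).
Local Notation n := (Defs.dim M).
Local Notation E := 'rV[R]_n.
Implicit Types (c : chart R n M) (U : set M).

Lemma chartK c p : atlas c -> chart_dom c p -> chart_inv c (c p) = p.
Proof. by move=> /chart_homeo[_ _ H _ _]; exact: H. Qed.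

Lemma chart_invK c x : atlas c -> chart_image c setT x -> c (chart_inv c x) = x.
Proof. by move=> ac [p [_ dp] <-]; rewrite chartK. Qed.

Lemma chart_inv_dom c U x : atlas c -> chart_image c U x ->
  (U `&` chart_dom c) (chart_inv c x).
Proof. by move=> ac [p [Up dp] <-]; rewrite chartK. Qed.

Lemma chart_image_sub c U U' : U `<=` U' -> chart_image c U `<=` chart_image c U'.
Proof. by move=> UU x [p [Up dp] <-]; exists p => //; split => //; exact: UU. Qed.

Lemma chart_imageE c U x : atlas c -> chart_image c setT x ->
  U (chart_inv c x) -> chart_image c U x.
Proof.
move=> ac xi Ux; exists (chart_inv c x); last exact: chart_invK.
by split => //; have [] := chart_inv_dom ac xi.
Qed.

Lemma open_chart_dom c : atlas c -> open (chart_dom c).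
Proof. by move=> /chart_homeo[]. Qed.

Lemma chart_continuous c p : atlas c -> chart_dom c p -> {for p, continuous c}.
Proof. by move=> /chart_homeo[_ _ _ H _] dp; apply: H; exact: mem_set. Qed.

Lemma chart_inv_continuous c x : atlas c -> chart_image c setT x ->
  {for x, continuous (chart_inv c)}.
Proof. by move=> /chart_homeo[_ _ _ _ H] dp; apply: H; exact: mem_set. Qed.

Lemma open_chart_image c U : atlas c -> open U -> open (chart_image c U).
Proof.
move=> ac oU; rewrite openE => x xU.
have xT : chart_image c setT x by exact: chart_image_sub xU.
have [_ oI _ _ _] := chart_homeo ac.
have H1 : nbhs x (chart_image c setT) by exact: open_nbhs_nbhs.
have H2 : nbhs x (chart_inv c @^-1` U).
  apply: (chart_inv_continuous ac xT); apply: open_nbhs_nbhs; split => //.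
  by have [] := chart_inv_dom ac xU.
by apply: filterS (filterI H1 H2) => y [yT Uy]; exact: chart_imageE.
Qed.

Lemma open_chart_preimage c (G : set E) : atlas c -> open G ->
  open (chart_dom c `&` c @^-1` G).
Proof.
move=> ac oG; rewrite openE => p [dp Gp].
have H1 : nbhs p (chart_dom c) by apply: open_nbhs_nbhs; split => //; exact: open_chart_dom.
have H2 : nbhs p (c @^-1` G).
  by apply: (chart_continuous ac dp); exact: open_nbhs_nbhs.
exact: filterI.
Qed.

Lemma compact_chart_inv c (K : set E) : atlas c -> compact K ->
  K `<=` chart_image c setT -> compact (chart_inv c @` K).
Proof.
move=> ac cK KI; apply: continuous_compact => //.
apply: continuous_in_subspaceT => x; rewrite inE => Kx.
by apply: chart_inv_continuous => //; exact: KI.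
Qed.

Lemma compact_chart c (K : set M) : atlas c -> compact K ->
  K `<=` chart_dom c -> compact (c @` K).
Proof.
move=> ac cK KI; apply: continuous_compact => //.
apply: continuous_in_subspaceT => x; rewrite inE => Kx.
by apply: chart_continuous => //; exact: KI.
Qed.

Lemma differentiable_rV (V : normedModType R) m (F : V -> 'rV[R]_m) x :
  (forall i, differentiable (fun y => F y ord0 i) x) -> differentiable F x.
Proof.
move=> dF.
have -> : F = \sum_(i < m) (fun y => F y ord0 i *: delta_mx ord0 i).
  apply/funext => y; rewrite fct_sumE; exact: row_sum_delta.
by apply: differentiable_sum => i; exact: differentiableZl.
Qed.

Lemma transition_differentiable c c' p : atlas c -> atlas c' ->
  chart_dom c p -> chart_dom c' p -> differentiable (c' \o chart_inv c) (c p).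
Proof.
move=> ac ac' dp dp'; apply: differentiable_rV => i.
by apply: (chart_transition i ac ac' [::]); exists p.
Qed.

Lemma change_of_chart_unit c p : atlas c -> chart_dom c p ->
  change_of_chart c p \in unitmx.
Proof.
move=> ac dp.
pose c' := chart_at p.
have ac' : atlas c' by exact: chart_at_atlas.
have dp' : chart_dom c' p by exact: chart_at_dom.
have FE : (c' \o chart_inv c) (c p) = c' p by rewrite /= chartK.
have dG : differentiable (c \o chart_inv c') ((c' \o chart_inv c) (c p)).
  by rewrite FE; exact: transition_differentiable.
have near_id : \forall x \near c p, (c \o chart_inv c') ((c' \o chart_inv c) x) = x.
  have o : open (chart_image c (chart_dom c')).
    by apply: open_chart_image => //; exact: open_chart_dom.
  have : nbhs (c p) (chart_image c (chart_dom c')).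
    by apply: open_nbhs_nbhs; split => //; exists p.
  apply: filterS => x [q [dq' dq] <-].
  by rewrite /= (chartK ac dq) (chartK ac' dq').
have dF := transition_differentiable ac ac' dp dp'.
have [u _] := mulmx1_unit (jacobian_inverse dF dG near_id).
exact: u.
Qed.

Definition chart_cover (P : set M) := countable P /\
  forall q, exists2 p, P p & chart_dom (chart_at p) q.

(** Each set of a countable base that fits in a preferred chart domain selects one such chart. The
    chart selected by a base set around [q] need not be [chart_at q], but its domain contains
    [q]. *)
Lemma countable_chart_cover : exists P : set M, chart_cover P.
Proof.
have [B cB [Bo Bb]] := manifold_second_countable M.
pose g (b : set M) : M := get [set p | b `<=` chart_dom (chart_at p)].
exists (g @` B); split; first exact: card_le_trans (card_image_le _ _) cB.
move=> q; have := Bb q (chart_dom (chart_at q)) _ => /(_ _)[].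
  apply: open_nbhs_nbhs; split; last exact: chart_at_dom.
  by apply: open_chart_dom; exact: chart_at_atlas.
move=> b [bB bq] bd; exists (g b); first by exists b.
have : exists p, [set p | b `<=` chart_dom (chart_at p)] p by exists q.
by move=> /getPex; rewrite -/(g b) => /(_ q bq).
Qed.

(** An injection of [P] into the naturals reindexes the union; each fibre holds at most one
    index. *)
Lemma countable_bigcup_measurable (I : Type) (P : set I) (F : I -> set (borel M)) :
  countable P -> (forall i, P i -> measurable (F i)) -> measurable (\bigcup_(i in P) F i).
Proof.
move=> /countable_injP[f finj] mF.
have -> : \bigcup_(i in P) F i = \bigcup_k \bigcup_(i in [set i | P i /\ f i = k]) F i.
  apply/seteqP; split => [x [i Pi Fx]|x [k _ [i [Pi _] Fx]]]; last by exists i.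
  by exists (f i) => //; exists i.
apply: bigcup_measurable => k _.
case: (pselect (exists i, P i /\ f i = k)) => [[i [Pi fi]]|nk].
  rewrite (_ : [set i | _] = [set i]) ?bigcup_set1; first exact: mF.
  apply/seteqP; split => [j [Pj fj]|j ->//].
  by apply: finj; rewrite ?inE// fj fi.
rewrite (_ : [set i | _] = set0) ?bigcup_set0//.
by apply/seteqP; split => // i Pi; apply: nk; exists i.
Qed.

Lemma measurable_fun_charts d (T : measurableType d) (U : set (borel M)) (f : borel M -> T) :
  @open M U ->
  (forall c, atlas c -> measurable_fun (U `&` chart_dom c) f) -> measurable_fun U f.
Proof.
move=> oU mf _ Y mY.
have [P [cP Pc]] := countable_chart_cover.
have -> : U `&` f @^-1` Y =
    \bigcup_(p in P) ((U `&` chart_dom (chart_at p)) `&` f @^-1` Y).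
  apply/seteqP; split => [q [Uq fq]|q [p Pp [[Uq _] fq]]//].
  by have [p Pp dq] := Pc q; exists p.
apply: countable_bigcup_measurable => // p _.
apply: mf => //; first exact: chart_at_atlas.
apply: open_measurable_borel; apply: openI => //.
by apply: open_chart_dom; exact: chart_at_atlas.
Qed.

Lemma chart_smooth_continuous c (f : M -> R) : atlas c ->
  smooth_on (chart_image c setT) (f \o chart_inv c) -> {in chart_dom c, continuous f}.
Proof.
move=> ac sf p; rewrite inE => dp.
have ip : chart_image c setT (c p) by exists p.
have cf : {for c p, continuous (f \o chart_inv c)}.
  exact/differentiable_continuous/(sf [::]).
have : {for p, continuous ((f \o chart_inv c) \o c)}.
  by apply: continuous_comp => //; exact: chart_continuous.
move=> H; rewrite /continuous_at.
have -> : f p = (f \o chart_inv c \o c) p by rewrite /= chartK.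
apply: cvg_trans H; apply: near_eq_cvg.
have : nbhs p (chart_dom c) by apply: open_nbhs_nbhs; split => //; exact: open_chart_dom.
by apply: filterS => q dq; rewrite /= chartK.
Qed.

Lemma smooth_fun_measurable (f : M -> R) : smooth_fun f ->
  measurable_fun setT (f : borel M -> R).
Proof.
move=> sf; apply: measurable_fun_charts; first exact: openT.
move=> c ac; rewrite setTI; apply: continuous_on_measurable; first exact: open_chart_dom.
by apply: chart_smooth_continuous => //; exact: sf.
Qed.

End manifold.

(** * Continuity of determinants and inverse matrices *)

Section matrix_continuity.
Variables (R : realType) (T : topologicalType) (x : T).

Lemma continuous_at_sum (I : Type) (r : seq I) (F : I -> T -> R) :
  (forall i, {for x, continuous (F i)}) ->
  {for x, continuous (fun t => \sum_(i <- r) F i t)}.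
Proof.
move=> cF; elim: r => [|i r IH].
  rewrite (_ : (fun _ => _) = cst 0); first exact: cvg_cst.
  by apply/funext => t; rewrite big_nil.
rewrite (_ : (fun _ => _) = F i + (fun t => \sum_(i <- r) F i t)); first exact: continuousD.
by apply/funext => t; rewrite big_cons.
Qed.

Lemma continuous_at_prod (I : Type) (r : seq I) (F : I -> T -> R) :
  (forall i, {for x, continuous (F i)}) ->
  {for x, continuous (fun t => \prod_(i <- r) F i t)}.
Proof.
move=> cF; elim: r => [|i r IH].
  rewrite (_ : (fun _ => _) = cst 1); first exact: cvg_cst.
  by apply/funext => t; rewrite big_nil.
rewrite (_ : (fun _ => _) = F i * (fun t => \prod_(i <- r) F i t)); first exact: continuousM.
by apply/funext => t; rewrite big_cons.
Qed.

Lemma continuous_at_det m (A : T -> 'M[R]_m) :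
  (forall i j, {for x, continuous (fun t => A t i j)}) ->
  {for x, continuous (fun t => \det (A t))}.
Proof.
move=> cA; apply: continuous_at_sum => s.
apply: (@continuousM _ _ (cst _)); first exact: cvg_cst.
by apply: continuous_at_prod => i; exact: cA.
Qed.

(** Cramer's formula. Invertibility is needed near [x], not just at [x], because [invmx] is given by
    this formula on invertible matrices only. *)
Lemma continuous_at_invmx m (A : T -> 'M[R]_m) i j :
  (forall i j, {for x, continuous (fun t => A t i j)}) ->
  (\forall t \near x, A t \in unitmx) ->
  {for x, continuous (fun t => invmx (A t) i j)}.
Proof.
move=> cA uA.
have ux : A x \in unitmx by exact: (nbhs_singleton uA).
have E0 : invmx (A x) i j = (\det (A x))^-1 * (\adj (A x)) i j by rewrite /invmx ux mxE.
have : {for x, continuous (fun t => (\det (A t))^-1 * (\adj (A t)) i j)}.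
  apply: continuousM.
    by apply: continuousV; [rewrite -unitfE -unitmxE|exact: continuous_at_det].
  rewrite (_ : (fun t => _) =
    fun t => (-1) ^+ (j + i) * \det (row' j (col' i (A t)))); last first.
    by apply/funext => t; rewrite mxE.
  apply: (@continuousM _ _ (cst _)); first exact: cvg_cst.
  apply: continuous_at_det => i' j'.
  rewrite (_ : (fun t => _) = fun t => A t (lift j i') (lift i j')); last first.
    by apply/funext => t; rewrite !mxE.
  exact: cA.
move=> H; rewrite /prop_for /continuous_at E0; apply: cvg_trans H; apply: near_eq_cvg.
by apply: filterS uA => t ut; rewrite /= /invmx ut [RHS]mxE.
Qed.

End matrix_continuity.

(** * The Riemannian density and the measurability of the norm *)

Section riemannian.
Variables (R : realType) (X : riemannianManifold R).
Local Notation n := (Defs.dim X).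
Implicit Types (c : chart R n X) (U : set X).

Lemma metric_pos_def (p : X) : pos_def (metric p).
Proof. by split; [exact: Defs.metric_sym|exact: Defs.metric_pos]. Qed.

Lemma metric_in_det_gt0 c p : atlas c -> chart_dom c p ->
  0 < \det (metric_in c (@metric R X) p).
Proof.
move=> ac dp; rewrite /metric_in; have [gs gp] := metric_pos_def p.
have [Q Qu ->] := cholesky gs gp.
rewrite !det_mulmx !det_tr.
have := change_of_chart_unit ac dp; rewrite unitmxE unitfE => C0.
move: Qu; rewrite unitmxE unitfE => Q0.
set C := \det _ in C0 *; set q := \det _ in Q0 *.
rewrite (_ : _ * _ = (C * q) ^+ 2); last by ring.
by rewrite exprn_even_gt0//= mulf_neq0.
Qed.

Lemma metric_in_continuous c i j : atlas c ->
  {in chart_dom c, continuous (fun p => metric_in c (@metric R X) p i j)}.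
Proof. by move=> ac; apply: chart_smooth_continuous => //; exact: metric_smooth. Qed.

Definition density c (p : X) : R := Num.sqrt (\det (metric_in c (@metric R X) p)).

Lemma density_gt0 c p : atlas c -> chart_dom c p -> 0 < density c p.
Proof. by move=> ac dp; rewrite sqrtr_gt0 metric_in_det_gt0. Qed.

Lemma density_continuous c : atlas c -> {in chart_dom c, continuous (density c)}.
Proof.
move=> ac p dp; apply: continuous_comp; last exact: sqrt_continuous.
by apply: continuous_at_det => i j; exact: metric_in_continuous.
Qed.

(* [chart_at p] need not depend measurably on [p]; the measurability of
   [form_normsq (metric p)] is read off in the fixed chart [c]. *)
Lemma form_normsq_chart k c p (f : 'M[R]_(k, n) -> R) : atlas c -> chart_dom c p ->
  Defs.alternating f ->
  form_normsq (metric p) f =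
  form_normsq (metric_in c (@metric R X) p) (fun v => f (v *m change_of_chart c p)).
Proof.
move=> ac dp fa; rewrite form_normsq_change//; first exact: metric_pos_def.
exact: change_of_chart_unit.
Qed.

Lemma measurable_form_normsq U k (a : Defs.form X k) : open U ->
  (forall p, U p -> Defs.alternating (a p)) -> measurable_form U a ->
  measurable_fun (U : set (borel X)) (fun p : borel X => form_normsq (metric p) (a p)).
Proof.
move=> oU alt ma; apply: measurable_fun_charts => // c ac.
have oUc : open (U `&` chart_dom c) by apply: openI => //; exact: open_chart_dom.
have mUc : measurable (U `&` chart_dom c : set (borel X)) by exact: open_measurable_borel.
apply: (eq_measurable_fun (fun p : borel X =>
  form_normsq (metric_in c (@metric R X) p) (form_in c a p))).
  by move=> p; rewrite inE => -[Up dp]; rewrite -form_normsq_chart//; exact: alt.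
apply: measurable_funM => //.
apply: measurable_sum => s; apply: measurable_sum => t.
apply: measurable_funM; last exact: ma.
apply: measurable_funM; last exact: ma.
apply: measurable_prod => i _.
apply: continuous_on_measurable => // p; rewrite inE => -[_ dp].
apply: continuous_at_invmx.
  by move=> i' j'; apply: metric_in_continuous => //; rewrite inE.
have : nbhs p (chart_dom c) by apply: open_nbhs_nbhs; split => //; exact: open_chart_dom.
by apply: filterS => q dq; rewrite unitmxE unitfE gt_eqF// metric_in_det_gt0.
Qed.

End riemannian.

(** * Square integrable forms *)

Section square_integrable.
Variables (R : realType) (X : riemannianManifold R).
Local Notation n := (Defs.dim X).
Implicit Types (c : chart R n X) (U V : set X) (nu : X -> R).

Definition weight nu := (forall p, 0 < nu p) /\ measurable_fun setT (nu : borel X -> R).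

Lemma open_domI c U : atlas c -> open U -> open (U `&` chart_dom c).
Proof. by move=> ac oU; apply: openI => //; exact: open_chart_dom. Qed.

Lemma measurable_domI c U : atlas c -> open U ->
  measurable (U `&` chart_dom c : set (borel X)).
Proof. by move=> ac oU; apply: open_measurable_borel; exact: open_domI. Qed.

Lemma measurable_formD U k (a b : Defs.form X k) :
  measurable_form U a -> measurable_form U b -> measurable_form U (a + b).
Proof. by move=> ma mb c s ac; apply: measurable_funD; [exact: ma|exact: mb]. Qed.

Lemma measurable_formN U k (a : Defs.form X k) :
  measurable_form U a -> measurable_form U (- a).
Proof. by move=> ma c s ac; apply: measurableT_comp => //; exact: ma. Qed.

Lemma measurable_form0 U k : measurable_form U (0 : Defs.form X k).
Proof. by move=> c s ac; exact: measurable_cst. Qed.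

Lemma measurable_form_sub U V k (a : Defs.form X k) : open U -> V `<=` U ->
  measurable_form U a -> measurable_form V a.
Proof.
move=> oU VU ma c s ac; apply: measurable_funS (ma c s ac).
  exact: measurable_domI.
by move=> p [Vp dp]; split => //; exact: VU.
Qed.

Lemma measurable_form_eq U k (a b : Defs.form X k) : (forall p, U p -> a p = b p) ->
  measurable_form U a -> measurable_form U b.
Proof.
move=> ab ma c s ac; apply: eq_measurable_fun (ma c s ac).
by move=> p; rewrite inE => -[Up _]; rewrite /form_in ab.
Qed.

Lemma L2_integrand_ge0 nu k (a : Defs.form X k) p : weight nu ->
  Defs.alternating (a p) -> (0 <= (nu p * form_normsq (metric p) (a p))%:E)%E.
Proof.
move=> [nu0 _] alt; rewrite lee_fin mulr_ge0 ?(ltW (nu0 p))//.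
by apply: form_normsq_ge0 => //; exact: metric_pos_def.
Qed.

Lemma L2_integrand_measurable nu U k (a : Defs.form X k) : weight nu -> open U ->
  (forall p, U p -> Defs.alternating (a p)) -> measurable_form U a ->
  measurable_fun (U : set (borel X))
    (fun p : borel X => (nu p * form_normsq (metric p) (a p))%:E).
Proof.
move=> [_ mnu] oU alt ma; apply/measurable_EFinP; apply: measurable_funM.
  exact: measurable_funTS.
exact: measurable_form_normsq.
Qed.

Lemma L2_normsqD_le nu U k (a b : Defs.form X k) : weight nu -> open U ->
  (forall p, U p -> Defs.alternating (a p)) -> measurable_form U a ->
  (forall p, U p -> Defs.alternating (b p)) -> measurable_form U b ->
  (L2_normsq nu U (a + b)%R <= 2%:E * L2_normsq nu U a + 2%:E * L2_normsq nu U b)%E.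
Proof.
move=> wnu oU aa ma ab mb; rewrite /L2_normsq.
have mU : measurable (U : set (borel X)) by exact: open_measurable_borel.
have ia := L2_integrand_measurable wnu oU aa ma.
have ib := L2_integrand_measurable wnu oU ab mb.
have pa p : U p -> (0 <= (nu p * form_normsq (metric p) (a p))%:E)%E.
  by move=> Up; apply: L2_integrand_ge0 => //; exact: aa.
have pb p : U p -> (0 <= (nu p * form_normsq (metric p) (b p))%:E)%E.
  by move=> Up; apply: L2_integrand_ge0 => //; exact: ab.
have aab p : U p -> Defs.alternating ((a + b) p).
  by move=> Up; apply: alternatingD; [exact: aa|exact: ab].
have two0 : (0 <= 2%:E :> \bar R)%E by rewrite lee_fin.
rewrite -!ge0_integralZl// -ge0_integralD//=; last 4 first.
- by move=> p Up; apply: mule_ge0 => //; exact: pa.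
- exact: measurable_funeM.
- by move=> p Up; apply: mule_ge0 => //; exact: pb.
- exact: measurable_funeM.
apply: ge0_le_integral => //=.
- by move=> p Up; apply: L2_integrand_ge0 => //; exact: aab.
- by apply: L2_integrand_measurable => //; exact: measurable_formD.
- by apply: emeasurable_funD; exact: measurable_funeM.
- move=> p Up; rewrite -!EFinM -EFinD lee_fin.
  have E (x y z : R) : 2 * (x * y) + 2 * (x * z) = x * (2 * y + 2 * z) by ring.
  rewrite E ler_wpM2l ?(ltW (wnu.1 p))//.
  apply: form_normsqD; [exact: metric_pos_def|exact: aa|exact: ab].
Qed.

Lemma L2_normsqN nu U k (a : Defs.form X k) : L2_normsq nu U (- a) = L2_normsq nu U a.
Proof. by apply: eq_integral => p _; rewrite -[in RHS]form_normsqN. Qed.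

Lemma L2_normsq0 nu U k : L2_normsq nu U (0 : Defs.form X k) = 0%E.
Proof. by apply: integral0_eq => p _; rewrite form_normsq0 mulr0. Qed.

Lemma L2D nu U k (a b : Defs.form X k) : weight nu -> open U ->
  L2 nu U a -> L2 nu U b -> L2 nu U (a + b).
Proof.
move=> wnu oU [aa ma na] [ab mb nb]; split.
- by move=> p Up; apply: alternatingD; [exact: aa|exact: ab].
- exact: measurable_formD.
- apply: le_lt_trans (L2_normsqD_le wnu oU aa ma ab mb) _.
  by rewrite lte_add_pinfty// lte_mul_pinfty// lee_fin.
Qed.

Lemma L2N nu U k (a : Defs.form X k) : L2 nu U a -> L2 nu U (- a).
Proof.
move=> [aa ma na]; split; [|exact: measurable_formN|by rewrite L2_normsqN].
by move=> p Up; apply: alternatingN; exact: aa.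
Qed.

Lemma L2_0 nu U k : L2 nu U (0 : Defs.form X k).
Proof.
split; [|exact: measurable_form0|by rewrite L2_normsq0].
by move=> p Up; exact: alternating0.
Qed.

Lemma L2B nu U k (a b : Defs.form X k) : weight nu -> open U ->
  L2 nu U a -> L2 nu U b -> L2 nu U (a - b).
Proof. by move=> wnu oU La Lb; apply: L2D => //; exact: L2N. Qed.

Lemma L2_sub nu U V k (a : Defs.form X k) : weight nu -> open U -> open V -> V `<=` U ->
  L2 nu U a -> L2 nu V a.
Proof.
move=> wnu oU oV VU [aa ma na]; split.
- by move=> p /VU; exact: aa.
- exact: measurable_form_sub ma.
- apply: le_lt_trans na; apply: ge0_subset_integral => //.
  + exact: open_measurable_borel.
  + exact: open_measurable_borel.
  + exact: L2_integrand_measurable.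
  + by move=> p Up; apply: L2_integrand_ge0 => //; exact: aa.
Qed.

Lemma L2_normsq_eq nu U k (a b : Defs.form X k) : (forall p, U p -> a p = b p) ->
  L2_normsq nu U a = L2_normsq nu U b.
Proof. by move=> ab; apply: eq_integral => p; rewrite inE => Up; rewrite ab. Qed.

Lemma L2_eq nu U k (a b : Defs.form X k) : (forall p, U p -> a p = b p) ->
  L2 nu U a -> L2 nu U b.
Proof.
move=> ab [aa ma na]; split.
- by move=> p Up; rewrite -ab//; exact: aa.
- exact: measurable_form_eq ma.
- by rewrite -(L2_normsq_eq _ ab).
Qed.

(** The union is cut into [U] and [V] minus [U]. The second piece is Borel but in general not open,
    so its contribution is bounded by the integral of [b] over all of [V]. *)
Lemma L2_glue nu U V k (a b phi : Defs.form X k) : weight nu -> open U -> open V ->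
  L2 nu U a -> L2 nu V b -> (forall p, U p -> phi p = a p) ->
  (forall p, V p -> ~ U p -> phi p = b p) -> L2 nu (U `|` V) phi.
Proof.
move=> wnu oU oV La Lb phia phib.
have mU : measurable (U : set (borel X)) by exact: open_measurable_borel.
have mV : measurable (V : set (borel X)) by exact: open_measurable_borel.
have mVU : measurable (V `\` U : set (borel X)) by exact: measurableD.
have oUV : open (U `|` V) by exact: openU.
have [aa ma na] : L2 nu U phi by apply: L2_eq La => p Up; rewrite phia.
have [ab mb nb] := Lb.
have UVE : U `|` V = U `|` (V `\` U).
  apply/seteqP; split => p; last by case=> [|[]]; [left|right].
  by case: (pselect (U p)) => Up; [left|case=> // Vp; right].
have alt p : (U `|` V) p -> Defs.alternating (phi p).
  rewrite UVE => -[Up|[Vp nUp]]; first exact: aa.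
  by rewrite phib//; exact: ab.
have mphi : measurable_form (U `|` V) phi.
  move=> c s ac; rewrite UVE setIUl; apply/measurable_funU.
  - exact: measurable_domI.
  - by apply: measurableI => //; apply: open_measurable_borel; exact: open_chart_dom.
  - split; first exact: ma.
    apply: (eq_measurable_fun (fun p : borel X => form_in c b p (frame R s))).
      by move=> p; rewrite inE => -[[Vp nUp] _]; rewrite /form_in phib.
    apply: measurable_funS (mb c s ac); first exact: measurable_domI.
    by move=> p [[]].
split => //.
have mi := L2_integrand_measurable wnu oUV alt mphi.
have i0 p : (U `|` V) p -> (0 <= (nu p * form_normsq (metric p) (phi p))%:E)%E.
  by move=> Up; apply: L2_integrand_ge0 => //; exact: alt.
rewrite /L2_normsq UVE in mi i0 *; rewrite ge0_integral_setU//; last first.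
  by apply/disj_setPS => p [Up [_]].
rewrite lte_add_pinfty//; apply: le_lt_trans nb; rewrite /L2_normsq.
under eq_integral => p do [rewrite inE => -[Vp nUp]; rewrite phib//].
apply: ge0_subset_integral => //.
+ exact: L2_integrand_measurable.
+ by move=> p Up; apply: L2_integrand_ge0 => //; exact: ab.
Qed.

Lemma L2_closure_sub nu U k (S : set (Defs.form X k)) a : S a -> L2 nu U a ->
  L2_closure nu U S a.
Proof.
by move=> Sa La; split => // e e0; exists a => //; rewrite subrr L2_normsq0.
Qed.

Lemma L2_closureB nu U k (S : set (Defs.form X k)) (a b : Defs.form X k) :
  weight nu -> open U -> (forall a, S a -> L2 nu U a) ->
  (forall a b, S a -> S b -> S (a - b)) ->
  L2_closure nu U S a -> L2_closure nu U S b -> L2_closure nu U S (a - b).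
Proof.
move=> wnu oU SL SB [La Ca] [Lb Cb]; split; first exact: L2B.
(* [L2_normsqD_le] puts a factor 2 on each of the two terms, and [2 * (e / 4) + 2 * (e / 4) = e]. *)
move=> e e0; have e40 : 0 < e / 4 by rewrite divr_gt0.
have [a' Sa' na'] := Ca _ e40; have [b' Sb' nb'] := Cb _ e40.
exists (a' - b'); first exact: SB.
rewrite (_ : a - b - (a' - b') = (a - a') - (b - b')); last first.
  by rewrite !opprB addrACA [RHS]addrACA; congr (_ + _); rewrite addrC.
have [aa ma _] := L2B wnu oU La (SL _ Sa').
have [ab mb _] := L2N (L2B wnu oU Lb (SL _ Sb')).
apply: (le_lt_trans (L2_normsqD_le wnu oU aa ma ab mb)); rewrite L2_normsqN.
have -> : e%:E = (2%:E * (e / 4)%:E + 2%:E * (e / 4)%:E)%E.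
  by rewrite -!EFinM -EFinD; congr (_%:E); field.
by apply: lteD; rewrite lte_pmul2l// lte_fin.
Qed.

End square_integrable.

(** * The distributional exterior derivative *)

Section weak_derivative.
Variables (R : realType) (X : riemannianManifold R).
Local Notation n := (Defs.dim X).
Local Notation vol := (@Defs.vol R X).
Local Notation E := 'rV[R]_n.
Implicit Types (c : chart R n X) (U V : set X) (h : X -> R) (f : E -> R).

Lemma compact_measurable_vol (K : set X) : compact K -> measurable (K : set (borel X)).
Proof. by move=> cK; apply: compact_measurable_borel => //; exact: manifold_hausdorff. Qed.

Definition locally_integrable c U h := forall K : set X, compact K ->
  K `<=` U `&` chart_dom c -> vol.-integrable (K : set (borel X)) (EFin \o h).

Definition test_integrand c h f (p : X) : R := h p * f (c p) / density c p.

Lemma chart_integralE c U h f :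
  chart_integral c (U `&` chart_dom c) (fun p => h p * f (c p)) =
  \int[vol]_(p in (U `&` chart_dom c : set (borel X))) test_integrand c h f p.
Proof. by []. Qed.

Lemma test_support_compact c U f : atlas c -> test_function (chart_image c U) f ->
  exists K : set X, [/\ compact K, K `<=` U `&` chart_dom c &
    forall p, chart_dom c p -> ~ K p -> f (c p) = 0].
Proof.
move=> ac [sf [K [cK KU f0]]]; exists (chart_inv c @` K); split.
- apply: compact_chart_inv => //; apply: subset_trans KU _.
  exact: chart_image_sub.
- by move=> _ [x Kx <-]; apply: chart_inv_dom => //; exact: KU.
- move=> p dp nKp; apply: f0 => Kp; apply: nKp; exists (c p) => //.
  exact: chartK.
Qed.

Lemma test_weight_continuous c f : atlas c -> smooth_on setT f ->
  {in chart_dom c, continuous (fun p => f (c p) / density c p)}.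
Proof.
move=> ac sf p; rewrite inE => dp.
apply: (@continuousM _ _ (f \o c) (fun p => (density c p)^-1)).
  apply: continuous_comp; first exact: chart_continuous.
  exact/differentiable_continuous/smooth_diff.
apply: continuousV; first by rewrite gt_eqF// density_gt0.
by apply: density_continuous => //; rewrite inE.
Qed.

Lemma integrableM_compact c (K : set X) h (g : X -> R) : atlas c -> compact K ->
  K `<=` chart_dom c -> {in chart_dom c, continuous g} ->
  vol.-integrable (K : set (borel X)) (EFin \o h) ->
  vol.-integrable (K : set (borel X)) (EFin \o (fun p => h p * g p)).
Proof.
move=> ac cK Kd cg ih; have mK := compact_measurable_vol cK.
apply: (integrableMl mK ih) => //.
  apply: measurable_funS (continuous_on_measurable (open_chart_dom ac) cg) => //.
  by apply: open_measurable_borel; exact: open_chart_dom.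
have : bounded_set (g @` K).
  apply: compact_bounded; apply: continuous_compact => //.
  apply: continuous_in_subspaceT => x; rewrite inE => /Kd dx; apply: cg; exact: mem_set.
move=> [M [Mr MP]]; exists M; split => // x Mx p Kp; apply: (MP x Mx).
by exists p.
Qed.

(** On [U] within the chart the integrand is the extension by 0 of a function on the compact support
    of the test function, where [h] is integrable and the continuous factor [f / density] is
    bounded. *)
Lemma test_integrable c U h f : atlas c -> open U -> locally_integrable c U h ->
  test_function (chart_image c U) f ->
  vol.-integrable (U `&` chart_dom c : set (borel X)) (EFin \o test_integrand c h f).
Proof.
move=> ac oU ih tf; have [K [cK KU f0]] := test_support_compact ac tf.
have mUc := measurable_domI ac oU.
have mK := compact_measurable_vol cK.
have Kd : K `<=` chart_dom c by move=> p /KU[].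
apply/(integrable_mkcond _ mUc).
rewrite (_ : _ \_ _ = (EFin \o (fun p => h p * (f (c p) / density c p))) \_ K); last first.
  apply/funext => p; rewrite !patchE /test_integrand /=.
  case: ifPn; rewrite (inE, notin_setE) => Up; case: ifPn; rewrite (inE, notin_setE) => Kp //.
  - by rewrite mulrA.
  - by rewrite f0 ?mulr0 ?mul0r//; case: Up.
  - by exfalso; apply: Up; exact: KU.
apply/(integrable_mkcond _ mK); apply: (integrableM_compact ac) => //; last exact: ih.
by apply: test_weight_continuous => //; case: tf.
Qed.

Lemma chart_integral_ext c U h1 f1 h2 f2 :
  (forall p, U p -> chart_dom c p -> h1 p * f1 (c p) = h2 p * f2 (c p)) ->
  chart_integral c (U `&` chart_dom c) (fun p => h1 p * f1 (c p)) =
  chart_integral c (U `&` chart_dom c) (fun p => h2 p * f2 (c p)).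
Proof.
by move=> H; apply: eq_Rintegral => p; rewrite inE => -[Up dp]; rewrite H.
Qed.

Lemma chart_integralDl c U h1 h2 f : atlas c -> open U ->
  locally_integrable c U h1 -> locally_integrable c U h2 ->
  test_function (chart_image c U) f ->
  chart_integral c (U `&` chart_dom c) (fun p => (h1 p + h2 p) * f (c p)) =
  chart_integral c (U `&` chart_dom c) (fun p => h1 p * f (c p)) +
  chart_integral c (U `&` chart_dom c) (fun p => h2 p * f (c p)).
Proof.
move=> ac oU i1 i2 tf; rewrite !chart_integralE -RintegralD; last 3 first.
- exact: measurable_domI.
- exact: test_integrable.
- exact: test_integrable.
by apply: eq_Rintegral => p _; rewrite /test_integrand !mulrDl.
Qed.

Lemma chart_integralDr c U h f1 f2 : atlas c -> open U -> locally_integrable c U h ->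
  test_function (chart_image c U) f1 -> test_function (chart_image c U) f2 ->
  chart_integral c (U `&` chart_dom c) (fun p => h p * (f1 + f2) (c p)) =
  chart_integral c (U `&` chart_dom c) (fun p => h p * f1 (c p)) +
  chart_integral c (U `&` chart_dom c) (fun p => h p * f2 (c p)).
Proof.
move=> ac oU ih tf1 tf2; rewrite !chart_integralE -RintegralD; last 3 first.
- exact: measurable_domI.
- exact: test_integrable.
- exact: test_integrable.
by apply: eq_Rintegral => p _; rewrite /test_integrand mulrDr mulrDl.
Qed.

Lemma chart_integralN c U h f : atlas c -> open U -> locally_integrable c U h ->
  test_function (chart_image c U) f ->
  chart_integral c (U `&` chart_dom c) (fun p => (- h p) * f (c p)) =
  - chart_integral c (U `&` chart_dom c) (fun p => h p * f (c p)).
Proof.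
move=> ac oU ih tf; rewrite !chart_integralE -mulN1r -RintegralZl; last 2 first.
- exact: measurable_domI.
- exact: test_integrable.
by apply: eq_Rintegral => p _; rewrite /test_integrand !mulNr mul1r.
Qed.

Lemma chart_integral0 c U (g : X -> R) :
  chart_integral c (U `&` chart_dom c) (fun p => 0 * g p) = 0.
Proof.
rewrite /chart_integral; under eq_Rintegral do rewrite !mul0r.
by rewrite /Rintegral integral0.
Qed.

Lemma chart_integral_sub c U V h f : atlas c -> V `<=` U ->
  test_function (chart_image c V) f ->
  chart_integral c (U `&` chart_dom c) (fun p => h p * f (c p)) =
  chart_integral c (V `&` chart_dom c) (fun p => h p * f (c p)).
Proof.
move=> ac VU tf; have [K [cK KV f0]] := test_support_compact ac tf.
rewrite /chart_integral Rintegral_mkcond [RHS]Rintegral_mkcond; congr (Rintegral _ _ _).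
apply/funext => p; rewrite !patchE.
case: ifPn; rewrite (inE, notin_setE) => Up; case: ifPn; rewrite (inE, notin_setE) => Vp //.
- by rewrite f0 ?mulr0 ?mul0r//; [case: Up|move=> /KV].
- by exfalso; apply: Up; case: Vp => /VU.
Qed.

Lemma locally_integrable_sub c U V h : V `<=` U -> locally_integrable c U h ->
  locally_integrable c V h.
Proof. by move=> VU ih K cK KV; apply: ih => // p /KV[/VU]. Qed.

Lemma chart_integral_ae c U h1 h2 f : atlas c -> open U ->
  locally_integrable c U h1 -> locally_integrable c U h2 ->
  {ae vol, forall p, (U `&` chart_dom c) p -> h1 p = h2 p} ->
  test_function (chart_image c U) f ->
  chart_integral c (U `&` chart_dom c) (fun p => h1 p * f (c p)) =
  chart_integral c (U `&` chart_dom c) (fun p => h2 p * f (c p)).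
Proof.
move=> ac oU i1 i2 h12 tf; rewrite !chart_integralE; congr fine.
apply: ae_eq_integral.
- exact: measurable_domI.
- exact: measurable_int (test_integrable ac oU i1 tf).
- exact: measurable_int (test_integrable ac oU i2 tf).
- apply: (@filterS _ _ (ae_filter_ringOfSetsType vol)) h12 => p H Up.
  by rewrite /test_integrand H.
Qed.

(** A face of a frame is again a frame, so facts stated for the coefficients of a form apply to the
    terms on the right of [weak_d]. *)
Lemma row'_frame k (s : {ffun 'I_k.+1 -> 'I_n}) i :
  row' i (frame R s) = frame R [ffun j => s (lift i j)].
Proof. by apply/matrixP => a b; rewrite !mxE ffunE. Qed.

Lemma form_locally_integrable U k (a : Defs.form X k) c (s : {ffun 'I_k -> 'I_n}) :
  atlas c -> locally_integrable_form U a ->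
  locally_integrable c U (fun p => form_in c a p (frame R s)).
Proof. by move=> ac ia K cK KU; exact: ia. Qed.

Lemma form_locally_integrable' U k (a : Defs.form X k) c (s : {ffun 'I_k.+1 -> 'I_n}) i :
  atlas c -> locally_integrable_form U a ->
  locally_integrable c U (fun p => form_in c a p (row' i (frame R s))).
Proof. by move=> ac ia; rewrite row'_frame; exact: form_locally_integrable. Qed.

Lemma locally_integrable_formD U k (a b : Defs.form X k) :
  locally_integrable_form U a -> locally_integrable_form U b ->
  locally_integrable_form U (a + b).
Proof.
move=> ia ib c s K ac cK KU; have mK := compact_measurable_vol cK.
by apply: eq_integrable (integrableD mK (ia c s K ac cK KU) (ib c s K ac cK KU)).
Qed.

Lemma locally_integrable_formN U k (a : Defs.form X k) :
  locally_integrable_form U a -> locally_integrable_form U (- a).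
Proof.
move=> ia c s K ac cK KU; have mK := compact_measurable_vol cK.
suff : vol.-integrable (K : set (borel X))
  (-%E \o (fun p => (form_in c a p (frame R s))%:E)) by [].
by apply: integrableN => //; exact: ia.
Qed.

Lemma locally_integrable_form0 U k : locally_integrable_form U (0 : Defs.form X k).
Proof.
move=> c s K ac cK KU; have mK := compact_measurable_vol cK.
exact: integrable0.
Qed.

Lemma weak_dD U k (a a' : Defs.form X k) b b' : open U ->
  weak_d U a b -> weak_d U a' b' -> weak_d U (a + a') (b + b').
Proof.
move=> oU [ia ib H] [ia' ib' H']; split; [exact: locally_integrable_formD..|].
move=> c f s ac tf.
rewrite [LHS](chart_integralDl (h1 := fun p => form_in c b p (frame R s))
  (h2 := fun p => form_in c b' p (frame R s)))//; try exact: form_locally_integrable.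
rewrite H// H'// -opprD -big_split/=; congr (- _); apply: eq_bigr => i _.
rewrite -mulrDr; congr (_ * _).
rewrite [RHS](chart_integralDl (h1 := fun p => form_in c a p (row' i (frame R s)))
  (h2 := fun p => form_in c a' p (row' i (frame R s))) (f := partial (s i) f))//;
  try exact: form_locally_integrable'.
exact: test_partial.
Qed.

Lemma weak_dN U k (a : Defs.form X k) b : open U ->
  weak_d U a b -> weak_d U (- a) (- b).
Proof.
move=> oU [ia ib H]; split; [exact: locally_integrable_formN..|].
move=> c f s ac tf.
rewrite [LHS](chart_integralN (h := fun p => form_in c b p (frame R s)))//;
  try exact: form_locally_integrable.
rewrite H//; congr (- _); rewrite -sumrN; apply: eq_bigr => i _.
rewrite -mulrN; congr (_ * _).
rewrite [RHS](chart_integralN (h := fun p => form_in c a p (row' i (frame R s)))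
  (f := partial (s i) f))//;
  try exact: form_locally_integrable'.
exact: test_partial.
Qed.

Lemma weak_dB U k (a a' : Defs.form X k) b b' : open U ->
  weak_d U a b -> weak_d U a' b' -> weak_d U (a - a') (b - b').
Proof. by move=> oU H H'; apply: weak_dD => //; exact: weak_dN. Qed.

Lemma weak_d0 U k : weak_d U (0 : Defs.form X k) 0.
Proof.
split; [exact: locally_integrable_form0..|].
move=> c f s ac tf; rewrite [LHS]chart_integral0 big1 ?oppr0// => i _.
by rewrite [X in _ * X]chart_integral0 mulr0.
Qed.

Lemma weak_d_sub U V k (a : Defs.form X k) b : V `<=` U ->
  weak_d U a b -> weak_d V a b.
Proof.
move=> VU [ia ib H]; split.
- by move=> c s K ac cK KV; apply: ia => // p /KV[/VU].
- by move=> c s K ac cK KV; apply: ib => // p /KV[/VU].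
move=> c f s ac tf.
have tfU : test_function (chart_image c U) f.
  exact: test_function_sub (chart_image_sub VU) tf.
rewrite -[LHS](@chart_integral_sub c U V (fun p => form_in c b p (frame R s)) f ac VU tf).
rewrite H//; congr (- _); apply: eq_bigr => i _; congr (_ * _).
exact: (@chart_integral_sub c U V (fun p => form_in c a p (row' i (frame R s)))
  (partial (s i) f) ac VU (test_partial _ tf)).
Qed.

Lemma weak_d_eq U k (a a' : Defs.form X k) b b' :
  (forall p, U p -> a p = a' p) -> (forall p, U p -> b p = b' p) ->
  weak_d U a b -> weak_d U a' b'.
Proof.
move=> aa' bb' [ia ib H]; split.
- move=> c s K ac cK KU; apply: eq_integrable (ia c s K ac cK KU).
    exact: compact_measurable_vol.
  by move=> p; rewrite inE => /KU[Up _]; rewrite /form_in aa'.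
- move=> c s K ac cK KU; apply: eq_integrable (ib c s K ac cK KU).
    exact: compact_measurable_vol.
  by move=> p; rewrite inE => /KU[Up _]; rewrite /form_in bb'.
move=> c f s ac tf.
have <- : chart_integral c (U `&` chart_dom c) (fun p => form_in c b p (frame R s) * f (c p)) =
  chart_integral c (U `&` chart_dom c) (fun p => form_in c b' p (frame R s) * f (c p)).
  apply: (@chart_integral_ext _ _ (fun p => form_in c b p (frame R s)) f) => p Up dp.
  by rewrite /form_in bb'.
rewrite H//; congr (- _); apply: eq_bigr => i _; congr (_ * _).
apply: (@chart_integral_ext _ _ (fun p => form_in c a p (row' i (frame R s)))
  (partial (s i) f)) => p Up dp.
by rewrite /form_in aa'.
Qed.

(** The equality that [weak_d] can see: the null set may depend on the chart and the frame, and
    nothing is said of other arguments of the form, which matters because [weak_d] does not require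
    alternation. *)
Definition chart_ae_eq U k (a a' : Defs.form X k) := forall c (s : {ffun 'I_k -> 'I_n}),
  atlas c -> {ae vol, forall p, (U `&` chart_dom c) p ->
    form_in c a p (frame R s) = form_in c a' p (frame R s)}.

Lemma weak_d_ae U k (a a' : Defs.form X k) b b' : open U ->
  chart_ae_eq U a a' -> chart_ae_eq U b b' ->
  locally_integrable_form U a' -> locally_integrable_form U b' ->
  weak_d U a b -> weak_d U a' b'.
Proof.
move=> oU aa' bb' ia' ib' [ia ib H]; split => // c f s ac tf.
have <- : chart_integral c (U `&` chart_dom c) (fun p => form_in c b p (frame R s) * f (c p)) =
  chart_integral c (U `&` chart_dom c) (fun p => form_in c b' p (frame R s) * f (c p)).
  apply: (@chart_integral_ae c U (fun p => form_in c b p (frame R s))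
    (fun p => form_in c b' p (frame R s)) f) => //.
  - exact: form_locally_integrable.
  - exact: form_locally_integrable.
  - exact: bb'.
rewrite H//; congr (- _); apply: eq_bigr => i _; congr (_ * _).
apply: (@chart_integral_ae c U (fun p => form_in c a p (row' i (frame R s)))
  (fun p => form_in c a' p (row' i (frame R s))) (partial (s i) f)) => //.
- exact: form_locally_integrable'.
- exact: form_locally_integrable'.
- by rewrite row'_frame; exact: aa'.
- exact: test_partial.
Qed.

Lemma ae_zero_chart_ae_eq U k (a b : Defs.form X k) : @ae_zero R X U k (a - b) ->
  chart_ae_eq U a b.
Proof.
move=> ab c s ac.
apply: (@filterS _ _ (ae_filter_ringOfSetsType vol)) ab => p H [Up _]; have := H Up.
move=> /(congr1 (fun g => g (frame R s *m change_of_chart c p))) /eqP.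
by rewrite subr_eq0 => /eqP.
Qed.

Lemma chart_ae_eq_refl U k (a : Defs.form X k) : chart_ae_eq U a a.
Proof. by move=> c s ac; apply: (@filterE _ _ (ae_filter_ringOfSetsType vol)). Qed.

End weak_derivative.

(** * Sign cancellation for iterated faces *)

Section alternating_sum.
Variables (R : realType) (k : nat).

(* Deleting row [x.1] and then row [x.2] of the rest is the same as deleting the
   same two rows in the other order; the sign changes. *)
Definition swap_faces (x : 'I_k.+2 * 'I_k.+1) : 'I_k.+2 * 'I_k.+1 :=
  (lift x.1 x.2, odflt x.2 (unlift (lift x.1 x.2) x.1)).

Lemma lift_swap_faces x : lift (swap_faces x).1 (swap_faces x).2 = x.1.
Proof.
rewrite /swap_faces/=; case: unliftP => [j <-//|/eqP].
by rewrite (negbTE (neq_lift _ _)).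
Qed.

Lemma swap_facesK : involutive swap_faces.
Proof.
move=> x; have E := lift_swap_faces x.
rewrite {1}/swap_faces E; case: x E => i j /= E; congr (_, _).
by rewrite liftK.
Qed.

Lemma swap_faces_sign x :
  odd ((swap_faces x).1 + (swap_faces x).2) = ~~ odd (x.1 + x.2).
Proof.
have /(congr1 (@nat_of_ord _)) := lift_swap_faces x.
case: x => i j; rewrite /swap_faces/=; set j' := odflt _ _; rewrite /= /bump.
move: (nat_of_ord i) (nat_of_ord j) (nat_of_ord j') => {}i {}j {}j'.
by case: (leqP i j) => ij; case: (leqP _ j') => jj H; lia.
Qed.

(** [swap_faces] is an involution that reverses every sign, so the sum is its own opposite. *)
Lemma sum_swap_faces (T : 'I_k.+2 -> 'I_k.+1 -> R) :
  (forall x, T (swap_faces x).1 (swap_faces x).2 = T x.1 x.2) ->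
  \sum_(i < k.+2) \sum_(j < k.+1) (-1) ^+ (i + j) * T i j = 0.
Proof.
move=> HT; rewrite pair_bigA /=; set S := \sum_p _.
suff : S = - S by move/eqP; rewrite -addr_eq0 -mulr2n mulrn_eq0/= => /eqP.
rewrite {1}/S (reindex_inj (inv_inj swap_facesK))/= -sumrN; apply: eq_bigr => x _.
by rewrite HT -signr_odd swap_faces_sign signrN mulNr signr_odd.
Qed.

Lemma row'_swap_faces n (A : 'M[R]_(k.+2, n)) x :
  row' (swap_faces x).2 (row' (swap_faces x).1 A) = row' x.2 (row' x.1 A).
Proof.
apply/matrixP => a b; rewrite !mxE; congr (A _ b).
apply/val_inj => /=.
have /(congr1 (@nat_of_ord _)) := lift_swap_faces x.
case: x => i j; rewrite /swap_faces/=; set j' := odflt _ _ => /= H.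
rewrite [RHS]bumpC; congr (bump _ (bump _ a)); move: H; rewrite /bump /unbump.
move: (nat_of_ord i) (nat_of_ord j) (nat_of_ord j') => {}i {}j {}j'.
by case: (leqP i j) => ij; case: (leqP _ j') => jj H; lia.
Qed.

End alternating_sum.

(** * The square of [d], and gluing of distributional derivatives *)

Section weak_derivative_local.
Variables (R : realType) (X : riemannianManifold R).
Local Notation n := (Defs.dim X).
Local Notation vol := (@Defs.vol R X).
Local Notation E := 'rV[R]_n.
Implicit Types (c : chart R n X) (U V : set X) (h : X -> R) (f : E -> R).

(** Moving both derivatives to the test function leaves terms [T i j] invariant under [swap_faces]:
    the same two rows are deleted, and the two partial derivatives commute. *)
Lemma weak_d_closed U k (a : Defs.form X k) b : weak_d U a b -> weak_d U b 0.
Proof.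
move=> [ia ib H]; split => //; first exact: locally_integrable_form0.
move=> c f s ac tf; rewrite [LHS]chart_integral0.
pose T (i : 'I_k.+2) (j : 'I_k.+1) := chart_integral c (U `&` chart_dom c)
  (fun p => form_in c a p (row' j (row' i (frame R s))) *
            partial (s (lift i j)) (partial (s i) f) (c p)).
have HT x : T (swap_faces x).1 (swap_faces x).2 = T x.1 x.2.
  case: x => i j; rewrite /T row'_swap_faces lift_swap_faces.
  by rewrite /= partial_comm//; case: tf.
have S0 := sum_swap_faces HT.
apply/esym/eqP; rewrite oppr_eq0; apply/eqP.
transitivity (- \sum_(i < k.+2) \sum_(j < k.+1) (-1) ^+ (i + j) * T i j).
  rewrite -sumrN; apply: eq_bigr => i _.
  rewrite row'_frame H//; last exact: test_partial.
  rewrite mulrN mulr_sumr; congr (- _); apply: eq_bigr => j _.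
  by rewrite mulrA -exprD /T (row'_frame s i) ffunE.
by clearbody T; rewrite S0 oppr0.
Qed.

Lemma chart_imageU c U V : chart_image c (U `|` V) = chart_image c U `|` chart_image c V.
Proof. by rewrite /chart_image setIUl image_setU. Qed.

Lemma integrable_setU_compact (K1 K2 : set X) (h : X -> \bar R) :
  compact K1 -> compact K2 ->
  vol.-integrable (K1 : set (borel X)) h -> vol.-integrable (K2 : set (borel X)) h ->
  vol.-integrable (K1 `|` K2 : set (borel X)) h.
Proof.
move=> c1 c2 /integrableP[m1 i1] /integrableP[m2 i2].
have mK1 := compact_measurable_vol c1; have mK2 := compact_measurable_vol c2.
apply/integrableP; split; first exact/measurable_funU.
have m21 : measurable (K2 `\` K1 : set (borel X)) by exact: measurableD.
have -> : K1 `|` K2 = K1 `|` (K2 `\` K1).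
  apply/seteqP; split => p; last by case=> [|[]]; [left|right].
  by case: (pselect (K1 p)) => Up; [left|case=> // Vp; right].
have m2' : measurable_fun (K2 `\` K1 : set (borel X)) h by apply: measurable_funS m2 => // p [].
rewrite ge0_integral_setU//; last 2 first.
- by apply: measurableT_comp => //; apply/measurable_funU.
- by apply/disj_setPS => p [Up [_]].
rewrite lte_add_pinfty//; apply: le_lt_trans i2.
by apply: ge0_subset_integral => //; exact: measurableT_comp.
Qed.

(** Cutoffs exist in R^n, so the compact set is split there, after applying the chart, and the two
    pieces are pulled back. *)
Lemma locally_integrable_glue c U V h : atlas c -> open U -> open V ->
  locally_integrable c U h -> locally_integrable c V h ->
  locally_integrable c (U `|` V) h.
Proof.
move=> ac oU oV iU iV K cK KUV.
have Kd : K `<=` chart_dom c by move=> p /KUV[].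
have KI : c @` K `<=` chart_image c U `|` chart_image c V.
  by rewrite -chart_imageU => _ [p Kp <-]; exists p => //; exact: KUV.
have [K1 [K2 [[c1 c2] K1U K2V KE]]] := compact_split (compact_chart ac cK Kd)
  (open_chart_image ac oU) (open_chart_image ac oV) KI.
have cinv (L : set E) (W : set X) : compact L -> L `<=` chart_image c W ->
    compact (chart_inv c @` L) /\ chart_inv c @` L `<=` W `&` chart_dom c.
  move=> cL LW; split.
    by apply: compact_chart_inv => //; apply: subset_trans LW _; exact: chart_image_sub.
  by move=> _ [x Lx <-]; apply: chart_inv_dom => //; exact: LW.
have [cK1 iK1] := cinv _ _ c1 K1U; have [cK2 iK2] := cinv _ _ c2 K2V.
have -> : K = chart_inv c @` K1 `|` chart_inv c @` K2.
  rewrite -image_setU -KE; apply/seteqP; split => [p Kp|_ [_ [p Kp <-] <-]].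
    by exists (c p); [exists p|rewrite chartK//; exact: Kd].
  by rewrite chartK//; exact: Kd.
by apply: integrable_setU_compact => //; [exact: iU|exact: iV].
Qed.

Lemma locally_integrable_form_glue U V k (a : Defs.form X k) : open U -> open V ->
  locally_integrable_form U a -> locally_integrable_form V a ->
  locally_integrable_form (U `|` V) a.
Proof.
move=> oU oV iU iV c s K ac cK KUV.
by apply: (locally_integrable_glue (c := c) (U := U) (V := V)) => //;
  exact: form_locally_integrable.
Qed.

(** Both sides of the defining identity are additive in the test function, which splits into one
    supported over [U] and one supported over [V]. *)
Lemma weak_d_glue U V k (a : Defs.form X k) b : open U -> open V ->
  weak_d U a b -> weak_d V a b -> weak_d (U `|` V) a b.
Proof.
move=> oU oV [iaU ibU HU] [iaV ibV HV].
have ia := locally_integrable_form_glue oU oV iaU iaV.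
have ib := locally_integrable_form_glue oU oV ibU ibV.
split => // c f s ac; rewrite chart_imageU => tf.
have oUV : open (U `|` V) by exact: openU.
have [f1 [f2 [t1 t2 ->]]] := test_function_split (open_chart_image ac oU)
  (open_chart_image ac oV) tf.
have UUV := @subsetUl _ U V; have VUV := @subsetUr _ U V.
have T1 : test_function (chart_image c (U `|` V)) f1.
  by apply: test_function_sub t1; exact: chart_image_sub.
have T2 : test_function (chart_image c (U `|` V)) f2.
  by apply: test_function_sub t2; exact: chart_image_sub.
rewrite [LHS](@chart_integralDr _ _ c (U `|` V) (fun p => form_in c b p (frame R s)))//;
  last exact: form_locally_integrable.
rewrite (@chart_integral_sub _ _ c (U `|` V) U (fun p => form_in c b p (frame R s)))//.
rewrite (@chart_integral_sub _ _ c (U `|` V) V (fun p => form_in c b p (frame R s)))//.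
rewrite HU// HV// -opprD -big_split/=; congr (- _); apply: eq_bigr => i _.
rewrite -mulrDr; congr (_ * _).
rewrite (partialD (s i) (proj1 t1) (proj1 t2)).
rewrite [RHS](@chart_integralDr _ _ c (U `|` V)
  (fun p => form_in c a p (row' i (frame R s))))//;
  try exact: test_partial; last exact: form_locally_integrable'.
rewrite (@chart_integral_sub _ _ c (U `|` V) U (fun p => form_in c a p (row' i (frame R s))))//;
  last exact: test_partial.
by rewrite (@chart_integral_sub _ _ c (U `|` V) V
  (fun p => form_in c a p (row' i (frame R s))))//;
  exact: test_partial.
Qed.

End weak_derivative_local.

(** * Uniqueness of the distributional derivative *)

Section vanishing.
Local Open Scope ereal_scope.

Lemma ae_countable d (T : measurableType d) (R : realType) (mu : {measure set T -> \bar R})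
    (I : Type) (D : set I) (P : I -> T -> Prop) : countable D ->
  (forall i, D i -> {ae mu, forall x, P i x}) ->
  {ae mu, forall x, forall i, D i -> P i x}.
Proof.
move=> /countable_injP[f finj] aeP.
have Q k : {ae mu, forall x, forall i, D i -> f i = k -> P i x}.
  case: (pselect (exists i, D i /\ f i = k)) => [[i [Di fi]]|nk].
    apply: (@filterS _ _ (ae_filter_ringOfSetsType mu) _ _ _ (aeP i Di)) => x Px j Dj fj.
    by rewrite (finj j i) ?inE// fj.
  apply: (@filterE _ _ (ae_filter_ringOfSetsType mu)) => x i Di fi.
  by exfalso; apply: nk; exists i.
have /(@ae_foralln _ _ _ mu) H := Q.
apply: (@filterS _ _ (ae_filter_ringOfSetsType mu) _ _ _ H) => x Hx i Di.
exact: (Hx (f i)).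
Qed.

(** Open sets form a pi-system generating the Borel sets, so Dynkin's theorem extends the vanishing
    of integrals from open to Borel sets. Integrability of [h] on [b] is what lets complements and
    countable unions through. *)
Lemma ae_eq0_open (T : ptopologicalType) (R : realType)
    (mu : {measure set (borel T) -> \bar R}) (b : set (borel T)) (h : borel T -> R) :
  measurable b -> mu.-integrable b (EFin \o h) ->
  (forall G : set T, open G -> \int[mu]_(p in b `&` G) (h p)%:E = 0) ->
  {ae mu, forall p, b p -> h p = 0%R}.
Proof.
move=> mb ih h0.
have H (E : set (borel T)) : measurable E -> \int[mu]_(p in b `&` E) (h p)%:E = 0.
  move=> mE; apply: (@dynkin_induction _ (borel T) (@open T)
    (fun E => \int[mu]_(p in b `&` E) (h p)%:E = 0)) => //.
  - exact: openI.
  - exact: (h0 setT openT).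
  - move=> S mS S0.
    have : \int[mu]_(p in (b `&` S) `|` (b `&` ~` S)) (h p)%:E = 0.
      by rewrite -setIUr setUv; exact: (h0 setT openT).
    have mh : measurable_fun b (EFin \o h) by exact: measurable_int ih.
    rewrite integral_setU.
    + by rewrite S0 add0e.
    + exact: measurableI.
    + by apply: measurableI => //; exact: measurableC.
    + by rewrite -setIUr setUv setIT.
    + by apply/disj_setPS => p [[_ Sp] [_ nSp]].
  - move=> F mF tF F0; rewrite setI_bigcupr integral_bigcup.
    + by apply: eseries0 => i _ _; exact: F0.
    + exact: trivIset_setIl.
    + by move=> k; exact: measurableI.
    + apply: (integrableS mb) => //.
        by apply: bigcup_measurable => k _; exact: measurableI.
      by apply: bigcup_sub => k _ p [].
have := @integral_ae_eq _ _ _ mu b mb (cst 0) (EFin \o h) ih _ _.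
move=> /(_ (@measurable_cst _ _ _ _ _ _)) K.
have {}K : ae_eq mu b (EFin \o h) (cst 0).
  apply: K => E Eb mE; rewrite integral_cst// mul0e -(H E mE).
  by rewrite (setIidr Eb).
by apply: (@filterS _ _ (ae_filter_ringOfSetsType mu) _ _ _ K) => p Hp bp; have [] := Hp bp.
Qed.

End vanishing.

(** * The fundamental lemma of the calculus of variations *)

Section fundamental_lemma.
Variables (R : realType) (X : riemannianManifold R).
Local Notation n := (Defs.dim X).
Local Notation vol := (@Defs.vol R X).
Local Notation E := 'rV[R]_n.
Implicit Types (c : chart R n X) (U V W : set X) (h : X -> R) (f : E -> R).

(** Inside a compact ball [h / density] is integrable, hence dominates its products with cutoffs;
    dominated convergence then makes its integral over every open subset of [b] vanish. *)
Lemma locally_vanishing c W h (x : E) r (b : set X) : atlas c -> open W ->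
  locally_integrable c W h ->
  (forall f, test_function (chart_image c W) f ->
    chart_integral c (W `&` chart_dom c) (fun p => h p * f (c p)) = 0) ->
  [set y | `|y - x| <= r] `<=` chart_image c W -> open b ->
  b `<=` chart_inv c @` [set y | `|y - x| <= r] ->
  {ae vol, forall p, b p -> h p = 0}.
Proof.
move=> ac oW ih h0 BW ob bB.
set B := [set y | _] in BW bB.
have cB : compact B by exact: closed_ball_rV_compact.
have cKb : compact (chart_inv c @` B).
  by apply: compact_chart_inv => //; apply: subset_trans BW _; exact: chart_image_sub.
have KbW : chart_inv c @` B `<=` W `&` chart_dom c.
  by move=> _ [y By <-]; apply: chart_inv_dom => //; exact: BW.
have bW : b `<=` W `&` chart_dom c by apply: subset_trans bB _.
have mb : measurable (b : set (borel X)) by exact: open_measurable_borel.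
have mKb := compact_measurable_vol cKb.
pose g (p : borel X) : R := h p * (density c p)^-1.
have ig : vol.-integrable (b : set (borel X)) (EFin \o g).
  apply: (integrableS mKb) => //.
  apply: (integrableM_compact ac cKb); last exact: ih.
    by move=> p /KbW[].
  move=> p dp; apply: continuousV; last exact: density_continuous.
  by rewrite gt_eqF// density_gt0//; move: dp; rewrite inE.
suff : {ae vol, forall p, b p -> g p = 0}.
  apply: (@filterS _ _ (ae_filter_ringOfSetsType vol)) => p H bp.
  have /eqP := H bp; rewrite mulf_eq0 invr_eq0 => /orP[/eqP//|].
  by rewrite gt_eqF// density_gt0//; have [] := bW p bp.
apply: ae_eq0_open => // G oG.
have obG : open (b `&` G) by exact: openI.
have mbG : measurable (b `&` G : set (borel X)) by exact: open_measurable_borel.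
have bGd : (b `&` G) `&` chart_dom c = b `&` G.
  by apply: setIidl => p [/bW[]].
have bGW : b `&` G `<=` W by move=> p [/bW[]].
have GB : chart_image c (b `&` G) `<=` B.
  by move=> _ [p [[bp _] dp] <-]; have [y By <-] := bB p bp; rewrite chart_invK//;
    apply: (chart_image_sub (@subsetT _ W)); exact: BW.
have [F [cF FG Fe]] := compact_exhaustion (open_chart_image ac obG) cB GB.
(* The cutoffs [chi m] converge to the indicator of the image of [b `&` G]. *)
have /choice[chi Hchi] : forall m, exists chi : E -> R,
    [/\ test_function (chart_image c (b `&` G)) chi,
    forall y, 0 <= chi y <= 1 & forall y, F m y -> chi y = 1].
  move=> m; have [chi [N [K' [schi chi01 [oN FN N1] cK' [K'G chi0]]]]] :=
    smooth_cutoff (cF m) (open_chart_image ac obG) (FG m).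
  exists chi; split => //; last by move=> y /FN/N1.
  by split => //; exists K'.
pose u m (p : borel X) : \bar R := (test_integrand c h (chi m) p)%:E.
have iu m : vol.-integrable (b `&` G : set (borel X)) (u m).
  have [tchi _ _] := Hchi m.
  rewrite -bGd; apply: test_integrable => //.
  exact: locally_integrable_sub ih.
have u0 m : (\int[vol]_(p in b `&` G) u m p = 0)%E.
  have [tchi _ _] := Hchi m.
  have := @chart_integral_sub _ _ c W (b `&` G) h (chi m) ac bGW tchi.
  rewrite h0; last by apply: test_function_sub tchi; exact: chart_image_sub.
  rewrite chart_integralE bGd /Rintegral => /esym/eqP.
  (* A real integral is [fine] of the extended one, and [fine] also sends the infinities to 0;
     finiteness excludes them. *)
  have fi : (\int[vol]_(p in b `&` G) u m p)%E \is a fin_num by exact: integrable_fin_num.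
  by rewrite fine_eq0// => /eqP.
have [||| | |_ _] := @dominated_convergence _ _ _ vol (b `&` G) mbG u (EFin \o g)
  (fun p => `|(g p)%:E|%E).
- by move=> m; exact: measurable_int (iu m).
- by apply: measurable_int; apply: integrableS ig => //; move=> p [].
- apply: (@filterE _ _ (ae_filter_ringOfSetsType vol)) => p bGp.
  apply: cvg_near_cst.
  have : chart_image c (b `&` G) (c p) by exists p => //; split => //; have [/bW[]] := bGp.
  move=> /Fe; apply: filterS => m Fm; have [_ _ chi1] := Hchi m.
  by rewrite /u /test_integrand chi1// mulr1.
- apply: integrable_abse; apply: integrableS ig => //; move=> p [].
- apply: (@filterE _ _ (ae_filter_ringOfSetsType vol)) => p m bGp.
  have [_ chi01 _] := Hchi m; have /andP[c0 c1] := chi01 (c p).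
  rewrite /u /test_integrand lee_fin mulrAC -/(g p) normrM.
  by rewrite ler_piMr// ger0_norm.
rewrite (_ : (fun n0 => _) = cst 0%E); last by apply/funext => m; exact: u0.
by move=> /(cvg_unique _ (cvg_cst _ (F := \oo))) => <-.
Qed.

(** The local null sets are united over the members of a countable base that fit in a closed chart
    ball; around every point of [W] in the chart there is one. *)
Lemma fundamental_lemma c W h : atlas c -> open W -> locally_integrable c W h ->
  (forall f, test_function (chart_image c W) f ->
    chart_integral c (W `&` chart_dom c) (fun p => h p * f (c p)) = 0) ->
  {ae vol, forall p, (W `&` chart_dom c) p -> h p = 0}.
Proof.
move=> ac oW ih h0.
have [B cB [Bo Bb]] := manifold_second_countable X.
pose D := [set b : set X | B b /\ exists (x : E) (r : R),
  [set y | `|y - x| <= r] `<=` chart_image c W /\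
  b `<=` chart_inv c @` [set y | `|y - x| <= r]].
have cD : countable D.
  by apply: sub_countable cB; apply: subset_card_le => b [].
have H : {ae vol, forall p b, D b -> b p -> h p = 0}.
  apply: ae_countable => // b [Bb' [x [r [xrW bxr]]]].
  by apply: (locally_vanishing (x := x) (r := r)) ac oW ih h0 _ _ _ => //; exact: Bo.
apply: (@filterS _ _ (ae_filter_ringOfSetsType vol) _ _ _ H) => p Hp [Wp dp].
have oI := open_chart_image ac oW.
have Ip : chart_image c W (c p) by exists p.
have /nbhs_ballP[e /= e0 eI] := open_nbhs_nbhs (conj oI Ip).
pose r := e / 2.
have r0 : 0 < r by rewrite divr_gt0.
have rI : [set y | `|y - c p| <= r] `<=` chart_image c W.
  move=> y /= yr; apply: eI; rewrite -ball_normE/= distrC (le_lt_trans yr)//.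
  by rewrite ltr_pdivrMr// ltr_pMr// ltr1n.
have oS := open_chart_preimage ac (ball_open (c p) r).
have Sp : nbhs p (chart_dom c `&` c @^-1` ball (c p) r).
  by apply: open_nbhs_nbhs; split => //; split => //; exact: ballxx.
have [b [bB bp] bS] := Bb p _ Sp.
apply: (Hp b) => //; split => //; exists (c p), r; split => // q /bS[dq].
rewrite /= -ball_normE/= distrC => /ltW cq; exists (c q) => //.
exact: chartK.
Qed.

(** Applied to differences, this is the uniqueness of the derivative: the coefficients of [xi]
    integrate to 0 against every test function. *)
Lemma weak_d_ae_zero W k (a : Defs.form X k) xi : open W -> chart_ae_eq W a 0 ->
  weak_d W a xi -> chart_ae_eq W xi 0.
Proof.
move=> oW a0 [ia ixi H] c s ac.
apply: (@fundamental_lemma c W (fun p => form_in c xi p (frame R s))) => //.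
  exact: form_locally_integrable.
move=> f tf; rewrite H// big1 ?oppr0// => i _.
rewrite (_ : chart_integral _ _ _ = 0) ?mulr0//.
rewrite [LHS](@chart_integral_ae _ _ c W _
  (fun p => form_in c (0 : Defs.form X k) p (row' i (frame R s))) (partial (s i) f))//.
- exact: chart_integral0.
- exact: form_locally_integrable'.
- exact/form_locally_integrable'/locally_integrable_form0.
- by rewrite row'_frame; exact: a0.
- exact: test_partial.
Qed.

End fundamental_lemma.

(** * The exact sequence *)

Section cohomology.
Variables (R : realType) (X : riemannianManifold R).
Local Notation n := (Defs.dim X).
Local Notation vol := (@Defs.vol R X).
Implicit Types (U V : set X) (nu mu w : X -> R).

Definition subgroup k (S : set (Defs.form X k)) :=
  S 0 /\ forall a b, S a -> S b -> S (a - b).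

Lemma subgroupN k (S : set (Defs.form X k)) a : subgroup S -> S a -> S (- a).
Proof. by move=> [S0 SB] Sa; rewrite -[- a]add0r; exact: SB. Qed.

Lemma subgroupD k (S : set (Defs.form X k)) a b : subgroup S -> S a -> S b -> S (a + b).
Proof. by move=> gS Sa Sb; rewrite -[b]opprK; apply: gS.2 => //; exact: subgroupN. Qed.

Lemma eq_coset k (Q : quotient X k) a b : subgroup (Defs.den Q) -> Defs.den Q (a - b) ->
  coset Q a = coset Q b.
Proof.
move=> gQ ab; apply/seteqP; split => x [nx dx]; split => //.
  by rewrite -(subrKA a); exact: subgroupD.
by rewrite -(subrKA b) -(opprB a b); apply: gQ.2.
Qed.

Lemma coset_den k (Q : quotient X k) a b : subgroup (Defs.den Q) -> Defs.num Q a ->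
  coset Q a = coset Q b -> Defs.den Q (a - b).
Proof.
move=> [d0 _] na e; have : coset Q a a by split => //; rewrite subrr.
by rewrite e => -[].
Qed.

Lemma ae_zero_subgroup U k : subgroup (@ae_zero R X U k).
Proof.
split; first by apply: (@filterE _ _ (ae_filter_ringOfSetsType vol)).
move=> a b Ha Hb.
apply: (@filterS2 _ _ (ae_filter_ringOfSetsType vol) _ _ _ _ Ha Hb) => p pa pb Up.
by rewrite (_ : (a - b) p = a p - b p)// pa// pb// subr0.
Qed.

Lemma L2_normsq_ae_zero nu U k (a : Defs.form X k) : weight nu -> open U ->
  L2 nu U a -> ae_zero U a -> L2_normsq nu U a = 0%E.
Proof.
move=> wnu oU [aa ma _] a0; rewrite /L2_normsq.
have mU : measurable (U : set (borel X)) by exact: open_measurable_borel.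
rewrite (@ae_eq_integral _ _ _ vol U (cst 0%E)) ?integral0//.
- exact: L2_integrand_measurable.
- apply: (@filterS _ _ (ae_filter_ringOfSetsType vol) _ _ _ a0) => p Hp Up.
  by rewrite Hp// form_normsq0 mulr0.
Qed.

Lemma exact_forms_L2 nu U k (a : Defs.form X k) : @exact_forms R X nu U k a -> L2 nu U a.
Proof. by case: k a => [a ->|k a [] //]; exact: L2_0. Qed.

Lemma exact_forms_subgroup nu U k : weight nu -> open U ->
  subgroup (@exact_forms R X nu U k).
Proof.
move=> wnu oU; case: k => [|k]; first by split => // a b -> ->; exact: subrr.
split.
  by split; [exact: L2_0|exists 0; [exact: L2_0|exact: weak_d0]].
move=> a b [La [a' La' da]] [Lb [b' Lb' db]]; split; first exact: L2B.
by exists (a' - b'); [exact: L2B|exact: weak_dB].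
Qed.

Lemma B_forms_subgroup nu U k : weight nu -> open U -> subgroup (@B_forms R X nu U k).
Proof.
move=> wnu oU; have [e0 eB] := exact_forms_subgroup k wnu oU; split.
  by apply: L2_closure_sub => //; exact: L2_0.
move=> a b; apply: L2_closureB => //; exact: exact_forms_L2.
Qed.

(** The exact form 0 is at distance 0, and [B_forms] is a closure. Thus an almost everywhere
    decomposition of a form determines its cohomology class, also in degree 0. *)
Lemma B_forms_ae_zero nu U k (a : Defs.form X k) : weight nu -> open U ->
  L2 nu U a -> ae_zero U a -> @B_forms R X nu U k a.
Proof.
move=> wnu oU La a0; split => // e e0; exists 0.
  by have [] := exact_forms_subgroup k wnu oU.
by rewrite subr0 L2_normsq_ae_zero.
Qed.

Lemma closed_forms_sub nu U V k (a : Defs.form X k) : weight nu -> open U -> open V ->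
  V `<=` U -> closed_forms nu U a -> closed_forms nu V a.
Proof.
by move=> wnu oU oV VU [La da]; split; [exact: L2_sub La|exact: weak_d_sub da].
Qed.

Lemma closed_formsB nu U k (a b : Defs.form X k) : weight nu -> open U ->
  closed_forms nu U a -> closed_forms nu U b -> closed_forms nu U (a - b).
Proof.
move=> wnu oU [La da] [Lb db]; split; first exact: L2B.
by rewrite -[0](subrr 0); exact: weak_dB.
Qed.

Lemma closed_forms0 nu U k : closed_forms nu U (0 : Defs.form X k).
Proof. by split; [exact: L2_0|exact: weak_d0]. Qed.

Lemma closed_C_forms w mu U k (a : Defs.form X k) :
  closed_forms (fun p => w p * mu p) U a -> C_forms w mu U a.
Proof. by move=> [La da]; split => //; exists 0 => //; exact: L2_0. Qed.

Lemma C_formsB w mu U k (a b : Defs.form X k) : weight mu ->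
  weight (fun p => w p * mu p) -> open U ->
  C_forms w mu U a -> C_forms w mu U b -> C_forms w mu U (a - b).
Proof.
move=> wmu wwmu oU [La [a' da La']] [Lb [b' db Lb']]; split; first exact: L2B.
by exists (a' - b'); [exact: weak_dB|exact: L2B].
Qed.

Lemma C_forms_sub w mu U V k (a : Defs.form X k) : weight mu ->
  weight (fun p => w p * mu p) -> open U -> open V -> V `<=` U ->
  C_forms w mu U a -> C_forms w mu V a.
Proof.
move=> wmu wwmu oU oV VU [La [a' da La']]; split; first exact: L2_sub La.
by exists a'; [exact: weak_d_sub da|exact: L2_sub La'].
Qed.

Lemma weak_d_ae_zero_l U k (a a' : Defs.form X k) b : open U -> ae_zero U (a - a') ->
  locally_integrable_form U a' -> weak_d U a b -> weak_d U a' b.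
Proof.
move=> oU aa' ia' dab; have [_ ib _] := dab.
apply: (weak_d_ae (a := a) (b := b)) => //; last exact: chart_ae_eq_refl.
exact: ae_zero_chart_ae_eq.
Qed.

(** Measurability of [h2] is a separate hypothesis because almost everywhere equality does not
    transfer it when the measure is not complete. *)
Lemma integrable_chart_ae_eq (K : set X) (h1 h2 : X -> R) : compact K ->
  measurable_fun (K : set (borel X)) (h2 : borel X -> R) ->
  {ae vol, forall p, K p -> h1 p = h2 p} ->
  vol.-integrable (K : set (borel X)) (EFin \o h1) ->
  vol.-integrable (K : set (borel X)) (EFin \o h2).
Proof.
move=> cK m2 h12 /integrableP[m1 i1]; have mK := compact_measurable_vol cK.
apply/integrableP; split; first exact/measurable_EFinP.
apply: le_lt_trans i1; rewrite le_eqVlt; apply/orP; left; apply/eqP.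
apply: ae_eq_integral => //.
- by apply: measurableT_comp => //; exact/measurable_EFinP.
- exact: measurableT_comp.
- by apply: (@filterS _ _ (ae_filter_ringOfSetsType vol) _ _ _ h12) => p Hp Kp; rewrite /= Hp.
Qed.

(** The glued form prefers [phiU] on the overlap, so on [V] it agrees with [phiV] only almost
    everywhere. Its local integrability on [V] is part of the conclusion because later uses of
    [weak_d_ae] ask for it. *)
Lemma glue_closed_forms mu U V k (phiU phiV : Defs.form X k) : weight mu ->
  open U -> open V -> closed_forms mu U phiU -> closed_forms mu V phiV ->
  chart_ae_eq (U `&` V) (phiU - phiV) 0 ->
  exists phi, [/\ closed_forms mu (U `|` V) phi, forall p, U p -> phi p = phiU p,
    chart_ae_eq V phiV phi & locally_integrable_form V phi].
Proof.
move=> wmu oU oV [LU dU] [LV dV] UV0.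
pose phi : Defs.form X k := fun p => if `[< U p >] then phiU p else phiV p.
have phiUE p : U p -> phi p = phiU p by move=> Up; rewrite /phi asboolT.
have phiVE p : ~ U p -> phi p = phiV p by move=> Up; rewrite /phi asboolF.
have Lphi : L2 mu (U `|` V) phi.
  by apply: (L2_glue wmu oU oV LU LV) => // p _; exact: phiVE.
have aeV : chart_ae_eq V phiV phi.
  move=> c s ac.
  apply: (@filterS _ _ (ae_filter_ringOfSetsType vol) _ _ _ (UV0 c s ac)) => p Hp [Vp dp].
  case: (pselect (U p)) => Up; last by rewrite /form_in phiVE.
  rewrite /form_in phiUE//; apply/esym/eqP; rewrite -subr_eq0; apply/eqP.
  by apply: Hp.
(* Measurability cannot be inherited from [phiV] across a null set; it comes from [Lphi]. *)
have iV : locally_integrable_form V phi.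
  move=> c s K ac cK KV; have [iV _ _] := dV.
  apply: (@integrable_chart_ae_eq K (fun p => form_in c phiV p (frame R s))) => //;
    last exact: iV.
    have [_ mphi _] := Lphi; have oUV : open (U `|` V) by exact: openU.
    apply: measurable_funS (mphi c s ac); first exact: measurable_domI.
    by move=> p /KV[Vp dp]; split => //; right.
  by apply: (@filterS _ _ (ae_filter_ringOfSetsType vol) _ _ _ (aeV c s ac)) => p Hp /KV.
exists phi; split => //; split => //.
apply: weak_d_glue => //.
  by apply: weak_d_eq dU => // p Up; rewrite phiUE.
apply: (weak_d_ae (a := phiV) (b := 0)) => //; first exact: chart_ae_eq_refl.
exact: locally_integrable_form0.
Qed.

Lemma weak_d_difference U V k (psiU psiV : Defs.form X k) phiU phiV eta xi :
  open U -> open V -> weak_d U psiU phiU -> weak_d V psiV phiV ->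
  weak_d (U `&` V) eta xi -> ae_zero (U `&` V) (eta - (psiU - psiV)) ->
  chart_ae_eq (U `&` V) (xi - (phiU - phiV)) 0.
Proof.
move=> oU oV dU dV de e0; have oUV : open (U `&` V) by exact: openI.
apply: (@weak_d_ae_zero _ _ (U `&` V) k (eta - (psiU - psiV))) => //.
  by apply: ae_zero_chart_ae_eq; rewrite subr0.
apply: weak_dB => //; apply: weak_dB => //.
  exact: weak_d_sub (@subIsetl _ U V) dU.
exact: weak_d_sub (@subIsetr _ U V) dV.
Qed.

(** * The diagram chase *)

Section mayer_vietoris.
Variables (w mu : X -> R) (U V : set X) (k : nat).
Hypotheses (wmu : weight mu) (wwmu : weight (fun p => w p * mu p)).
Hypotheses (oU : open U) (oV : open V) (UV : U `|` V = setT).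
Let oUV : open (U `&` V) := openI oU oV.
Let oX : open [set: X] := openT.
Hypotheses (acX : @almost_closed R X w mu setT k) (acU : @almost_closed R X w mu U k)
  (acV : @almost_closed R X w mu V k) (acUV : @almost_closed R X w mu (U `&` V) k).
Let CX := @C_space R X w mu setT k.
Let CU := @C_space R X w mu U k.
Let CV := @C_space R X w mu V k.
Let CUV := @C_space R X w mu (U `&` V) k.
Hypotheses (exact_CU_CV : exact_at (restriction CX CU CV) (difference CU CV CUV)
                            (coset CUV 0))
  (exact_CUV : exact_at (difference CU CV CUV) (to_zero CUV) tt).

(** Equality of cosets in [C_space] is equality almost everywhere, so surjectivity of the difference
    map gives a decomposition only up to a null set. *)
Lemma C_forms_split gamma : C_forms w mu (U `&` V) gamma ->
  exists a b, [/\ C_forms w mu U a, C_forms w mu V b &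
    @ae_zero R X (U `&` V) k (gamma - (a - b))].
Proof.
move=> Cg.
have [x [a [b [Ca Cb _ e]]]] : exists x, difference CU CV CUV x (coset CUV gamma).
  by apply/exact_CUV; exists gamma.
by exists a, b; split => //; apply: coset_den e => //; exact: ae_zero_subgroup.
Qed.

Lemma C_forms_glue a b : C_forms w mu U a -> C_forms w mu V b ->
  @ae_zero R X (U `&` V) k (a - b) ->
  exists alpha, [/\ C_forms w mu setT alpha, @ae_zero R X U k (a - alpha) &
    @ae_zero R X V k (b - alpha)].
Proof.
move=> Ca Cb ab.
have [x [alpha Calpha [_ [eU eV]]]] :
    exists x, restriction CX CU CV x (coset CU a, coset CV b).
  apply/exact_CU_CV; exists a, b; split => //.
  apply/esym/eq_coset; first exact: ae_zero_subgroup.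
  by rewrite subr0.
exists alpha; split => //.
  by apply: coset_den eU => //; exact: ae_zero_subgroup.
by apply: coset_den eV => //; exact: ae_zero_subgroup.
Qed.

Let B_formsE W (acW : @almost_closed R X w mu W k) b :
  @B_forms R X mu W k.+1 b <-> L2 mu W b /\ exists2 a, C_forms w mu W a & weak_d W a b.
Proof. by have [_ <-] := acW. Qed.

(** Since [eta] is closed, the derivatives of [psiU] and [psiV] agree almost everywhere on the
    overlap; each is closed as a derivative, so they glue. *)
Lemma connecting_form_exists eta : closed_forms (fun p => w p * mu p) (U `&` V) eta ->
  exists y, connecting_form w mu U V (k := k) eta y.
Proof.
move=> Zeta; have [psiU [psiV [CpU CpV e]]] := C_forms_split (closed_C_forms Zeta).
have [_ [phiU dU LU]] := CpU; have [_ [phiV dV LV]] := CpV.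
have UV0 : chart_ae_eq (U `&` V) (phiU - phiV) 0.
  apply: (@weak_d_ae_zero _ _ _ _ (psiU - psiV - eta)) => //.
    apply: ae_zero_chart_ae_eq; rewrite subr0 -opprB.
    by apply: subgroupN => //; exact: ae_zero_subgroup.
  rewrite -[phiU - phiV]subr0; apply: weak_dB => //; last by case: Zeta.
  apply: weak_dB => //.
    exact: weak_d_sub (@subIsetl _ U V) dU.
  exact: weak_d_sub (@subIsetr _ U V) dV.
have ZU : closed_forms mu U phiU by split => //; exact: weak_d_closed dU.
have ZV : closed_forms mu V phiV by split => //; exact: weak_d_closed dV.
have [phi [Zphi phiUE phiVE iV]] := glue_closed_forms wmu oU oV ZU ZV UV0.
rewrite UV in Zphi.
exists (coset (H_space mu setT k.+1) phi), psiU, psiV, phi; split => //; split.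
  by apply: weak_d_eq dU => // p Up; rewrite phiUE.
apply: (weak_d_ae (a := psiV) (b := phiV)) => //; first exact: chart_ae_eq_refl.
by case: dV.
Qed.

(** Two choices differ by a pair that agrees almost everywhere on the overlap. It comes from a
    single [alpha] on the whole space, and [d alpha = phi - phi'] lies in [B_forms]. *)
Lemma connecting_form_unique eta y y' : connecting_form w mu U V (k := k) eta y ->
  connecting_form w mu U V (k := k) eta y' -> y = y'.
Proof.
move=> [psiU [psiV [phi [[CU0 CV0] e0 Zphi [dU dV] ->]]]].
move=> [psiU' [psiV' [phi' [[CU0' CV0'] e0' Zphi' [dU' dV'] ->]]]].
apply: eq_coset; first exact: B_forms_subgroup.
have [||| alpha [Calpha aU aV]] := @C_forms_glue (psiU - psiU') (psiV - psiV').
- exact: C_formsB.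
- exact: C_formsB.
- rewrite (_ : _ - _ = (eta - (psiU' - psiV')) - (eta - (psiU - psiV))).
    by apply: (ae_zero_subgroup _ _).2.
  rewrite !opprB [RHS]addrC subrKA.
  by rewrite addrACA [RHS]addrACA; congr (_ + _); rewrite addrC.
apply/(B_formsE acX); split; first by apply: L2B => //; [case: Zphi|case: Zphi'].
exists alpha => //; rewrite -UV.
(* From the derivative that [alpha] has by membership only local integrability is taken; that its
   derivative is [phi - phi'] is checked on [U] and on [V] and then glued. *)
have [_ [beta [ia _ _] _]] := Calpha.
apply: weak_d_glue => //.
- apply: weak_d_ae_zero_l aU _ _ => //; last exact: weak_dB.
  by move=> c s K ac cK KU; apply: ia => // p /KU[].
- apply: weak_d_ae_zero_l aV _ _ => //; last exact: weak_dB.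
  by move=> c s K ac cK KU; apply: ia => // p /KU[].
Qed.

Let wm := fun p => w p * mu p.
Let H1U := @H_space R X wm U k.
Let H1V := @H_space R X wm V k.
Let H1UV := @H_space R X wm (U `&` V) k.
Let H2X := @H_space R X mu setT k.+1.
Let H2U := @H_space R X mu U k.+1.
Let H2V := @H_space R X mu V k.+1.
Let H2UV := @H_space R X mu (U `&` V) k.+1.

(** As [connecting] is a relation, the class of [a - b] may be represented by [a - b] itself, with
    [phi = 0]. Conversely, if [phi = d alpha] then [psiU - alpha] and [psiV - alpha] are closed, and
    their difference is [eta] almost everywhere. *)
Lemma exact_at_H1UV : exact_at (difference H1U H1V H1UV) (connecting w mu U V (k := k))
  (coset H2X 0).
Proof.
move=> y; split => [[x [a [b [Za Zb _ ->]]]]|].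
  exists (a - b); split => //.
    apply: closed_formsB => //.
      exact: closed_forms_sub (@subIsetl _ U V) Za.
    exact: closed_forms_sub (@subIsetr _ U V) Zb.
  exists a, b, 0; split => //.
  - by split; exact: closed_C_forms.
  - by rewrite subrr; have [] := ae_zero_subgroup (U `&` V) k.
  - exact: closed_forms0.
  - by split; [case: Za|case: Zb].
move=> [eta [Zeta -> [psiU [psiV [phi [[CU0 CV0] e0 Zphi [dU dV] e]]]]]].
have /(B_formsE acX)[Lphi [alpha Calpha dalpha]] : @B_forms R X mu setT k.+1 phi.
  rewrite -[phi]subr0; apply: (@coset_den _ H2X) (esym e) => //.
  exact: B_forms_subgroup.
have Z (W : set X) psi : open W -> C_forms w mu W psi -> weak_d W psi phi ->
    closed_forms wm W (psi - alpha).
  move=> oW [Lpsi _] dpsi; have [Lalpha _] := Calpha.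
  split; first by apply: L2B => //; exact: (L2_sub wwmu oX oW).
  rewrite -[0](subrr phi); apply: weak_dB => //.
  exact: weak_d_sub (@subsetT _ W) dalpha.
exists (coset H1U (psiU - alpha), coset H1V (psiV - alpha)).
exists (psiU - alpha), (psiV - alpha); split => //; [exact: Z|exact: Z|].
apply: eq_coset; first exact: B_forms_subgroup.
rewrite (_ : psiU - alpha - (psiV - alpha) = psiU - psiV); last first.
  by rewrite opprB addrA subrK.
apply: B_forms_ae_zero => //.
apply: L2B => //; first by case: Zeta.
apply: L2B => //.
  by apply: (L2_sub wwmu oU oUV) => //; case: CU0.
by apply: (L2_sub wwmu oV oUV) => //; case: CV0.
Qed.

(** A form [phi] from the connecting map is [d psiU] on [U] and [d psiV] on [V]. Conversely,
    primitives of [a] on [U] and on [V] have a closed difference on the overlap; being in the spaces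
    C, they make it square integrable for the weight [w * mu]. *)
Lemma exact_at_H2X : exact_at (connecting w mu U V (k := k)) (restriction H2X H2U H2V)
  (coset H2U 0, coset H2V 0).
Proof.
move=> y; split => [[x [eta [Zeta _ [psiU [psiV [phi [[CU0 CV0] e0 Zphi [dU dV] ->]]]]]]]|].
  exists phi => //; split => //; congr (_, _); apply/esym/eq_coset;
    try exact: B_forms_subgroup.
  - rewrite subr0; apply/(B_formsE acU); split; last by exists psiU.
    by apply: (L2_sub wmu oX oU) => //; case: Zphi.
  - rewrite subr0; apply/(B_formsE acV); split; last by exists psiV.
    by apply: (L2_sub wmu oX oV) => //; case: Zphi.
move=> [a Za [-> [eU eV]]].
have ZaU : closed_forms mu U a by exact: closed_forms_sub (@subsetT _ U) Za.
have ZaV : closed_forms mu V a by exact: closed_forms_sub (@subsetT _ V) Za.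
have /(B_formsE acU)[_ [psiU CpU dU]] : @B_forms R X mu U k.+1 a.
  rewrite -[a]subr0; apply: (@coset_den _ H2U) (esym eU) => //.
  exact: B_forms_subgroup.
have /(B_formsE acV)[_ [psiV CpV dV]] : @B_forms R X mu V k.+1 a.
  rewrite -[a]subr0; apply: (@coset_den _ H2V) (esym eV) => //.
  exact: B_forms_subgroup.
exists (coset H1UV (psiU - psiV)), (psiU - psiV); split => //.
  split.
    have C1 := C_forms_sub wmu wwmu oU oUV (@subIsetl _ U V) CpU.
    have C2 := C_forms_sub wmu wwmu oV oUV (@subIsetr _ U V) CpV.
    by have [] := C_formsB wmu wwmu oUV C1 C2.
  rewrite -[0](subrr a); apply: weak_dB => //.
    exact: weak_d_sub (@subIsetl _ U V) dU.
  exact: weak_d_sub (@subIsetr _ U V) dV.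
exists psiU, psiV, a; split => //.
by rewrite subrr; have [] := ae_zero_subgroup (U `&` V) k.
Qed.

(** Write [alpha - beta = d gamma] and split [gamma] as [a - b]. The corrected forms [alpha - d a]
    and [beta - d b] keep their classes and agree almost everywhere on the overlap, hence glue. *)
Lemma exact_at_H2U_H2V : exact_at (restriction H2X H2U H2V) (difference H2U H2V H2UV)
  (coset H2UV 0).
Proof.
move=> y; split => [[x [a Za [_ ->]]]|[alpha [beta [Zalpha Zbeta -> e]]]].
  exists a, a; split => //; last by rewrite subrr.
    exact: closed_forms_sub (@subsetT _ U) Za.
  exact: closed_forms_sub (@subsetT _ V) Za.
have ZUV : closed_forms mu (U `&` V) (alpha - beta).
  apply: closed_formsB => //.
    exact: closed_forms_sub (@subIsetl _ U V) Zalpha.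
  exact: closed_forms_sub (@subIsetr _ U V) Zbeta.
have /(B_formsE acUV)[_ [gamma Cg dg]] : @B_forms R X mu (U `&` V) k.+1 (alpha - beta).
  rewrite -[alpha - beta]subr0; apply: (@coset_den _ H2UV) (esym e) => //.
  exact: B_forms_subgroup.
have [a [b [Ca Cb eg]]] := C_forms_split Cg.
have [_ [a' da La']] := Ca; have [_ [b' db Lb']] := Cb.
have Za' : closed_forms mu U a' by split => //; exact: weak_d_closed da.
have Zb' : closed_forms mu V b' by split => //; exact: weak_d_closed db.
have UV0 : chart_ae_eq (U `&` V) ((alpha - a') - (beta - b')) 0.
  rewrite (_ : _ - _ = (alpha - beta) - (a' - b')); last first.
    by rewrite !opprB addrACA [RHS]addrACA; congr (_ + _); rewrite addrC.
  exact: weak_d_difference da db dg eg.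
have [phi [Zphi phiUE phiVE iV]] := glue_closed_forms wmu oU oV
  (closed_formsB wmu oU Zalpha Za') (closed_formsB wmu oV Zbeta Zb') UV0.
rewrite UV in Zphi.
exists (coset H2X phi), phi => //; split => //; congr (_, _).
- apply: eq_coset; first exact: B_forms_subgroup.
  have E p : U p -> a' p = (alpha - phi) p.
    move=> Up; rewrite (_ : (alpha - phi) p = alpha p - phi p)// phiUE//.
    by rewrite (_ : (alpha - a') p = alpha p - a' p)// opprB addrC subrK.
  apply/(B_formsE acU); split; first exact: L2_eq E La'.
  by exists a => //; apply: weak_d_eq E da.
- apply: eq_coset; first exact: B_forms_subgroup.
  have [LX _] := Zphi; have [Lb [ib _ _]] := Zbeta.
  apply/(B_formsE acV); split.
    by apply: L2B => //; exact: (L2_sub wmu oX oV).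
  (* On [U] the form [alpha - phi] is [a'] pointwise, but on [V] the form [beta - phi] is [b'] only
     almost everywhere, so the two sides need different arguments. *)
  exists b => //; apply: (weak_d_ae (a := b) (b := b')) => //.
  + exact: chart_ae_eq_refl.
  + move=> c s ac.
    apply: (@filterS _ _ (ae_filter_ringOfSetsType vol) _ _ _ (phiVE c s ac)) => p Hp Vp.
    have := Hp Vp; rewrite /form_in => H.
    set v := _ *m _ in H *.
    transitivity (beta p v - phi p v) => //.
    rewrite -H; transitivity (beta p v - (beta p v - b' p v)) => //.
    by rewrite opprB addrC subrK.
  + by case: db.
  + by apply: locally_integrable_formD => //; exact: locally_integrable_formN.
Qed.

End mayer_vietoris.

End cohomology.

Theorem mainTheorem3 (R : realType) (X : riemannianManifold R)
    (mu w : X -> R) (U V : set X) (k : nat)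
    (mu_smooth : smooth_fun mu) (mu_pos : forall p, 0 < mu p)
    (w_smooth : smooth_fun w) (w_pos : forall p, 0 < w p)
    (w_bounded : exists C : R, forall p, w p <= C)
    (U_open : open U) (V_open : open V) (UV : U `|` V = setT)
    (acX : almost_closed w mu setT k)
    (acU : almost_closed w mu U k)
    (acV : almost_closed w mu V k)
    (acUV : almost_closed w mu (U `&` V) k)
    (CX := C_space w mu setT k) (CU := C_space w mu U k)
    (CV := C_space w mu V k) (CUV := C_space w mu (U `&` V) k)
    (exact_CX : exact_at (from_zero CX) (restriction CX CU CV)
                         (coset CU 0, coset CV 0))
    (exact_CU_CV : exact_at (restriction CX CU CV) (difference CU CV CUV)
                            (coset CUV 0))
    (exact_CUV : exact_at (difference CU CV CUV) (to_zero CUV) tt) :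
  let wmu := fun p => w p * mu p in
  let H1U := H_space wmu U k in
  let H1V := H_space wmu V k in
  let H1UV := H_space wmu (U `&` V) k in
  let H2X := H_space mu setT k.+1 in
  let H2U := H_space mu U k.+1 in
  let H2V := H_space mu V k.+1 in
  let H2UV := H_space mu (U `&` V) k.+1 in
  (forall eta, closed_forms wmu (U `&` V) eta ->
     exists! y, connecting_form w mu U V (k := k) eta y) /\
  [/\ exact_at (difference H1U H1V H1UV) (connecting w mu U V (k := k))
               (coset H2X 0),
      exact_at (connecting w mu U V (k := k)) (restriction H2X H2U H2V)
               (coset H2U 0, coset H2V 0)
    & exact_at (restriction H2X H2U H2V) (difference H2U H2V H2UV)
               (coset H2UV 0)].
Proof.
have mmu := smooth_fun_measurable mu_smooth.
have mw := smooth_fun_measurable w_smooth.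
have wmu : weight mu by [].
have wwmu : weight (fun p => w p * mu p).
  by split=> [p|]; [exact: mulr_gt0|exact: measurable_funM].
split; last split.
- move=> eta Zeta.
  have [y Hy] := connecting_form_exists wmu U_open V_open UV exact_CUV Zeta.
  exists y; split => // y'; exact: connecting_form_unique exact_CU_CV _ _ _ Hy.
- exact: exact_at_H1UV.
- exact: exact_at_H2X.
- exact: exact_at_H2U_H2V exact_CUV.
Qed.
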